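(* Let $n$ be a positive integer, let $m,t$ be positive divisors of $n$ with $n\nmid mt$, let $\zeta\in\Bbbk$ be a primitive $n$-th root of unity, and let $N=\operatorname{ord}(\zeta^{mt})=\frac{n}{\gcd(n,mt)}$. The Drinfel'd double $D(H_n(\zeta,m,t))$ is generated by grouplike elements $y$ and $Y$, a $(y^m,1)$-skew primitive element $x$, and a $(1,Y^t)$-skew primitive element $X$, subject to the relations $$y^n=Y^n=1,\quad x^N=X^N=0,\quad yx=\zeta^txy,\quad YX=\zeta^mXY,$$ $$yY=Yy,\quad xY=\zeta^mYx,\quad yX=\zeta^{-t}Xy,\quad xX-Xx=Y^t-y^m.$$
   Context: $\Bbbk$ is an algebraically closed field of characteristic $0$. For grouplike elements $g,h$, an element $c$ is $(g,h)$-skew primitive if $\Delta(c)=g\otimes c+c\otimes h$. $H_n(\zeta,m,t)$ is the Hopf algebra generated as a $\Bbbk$-algebra by $y,x$ subject to $y^n=1$, $x^N=0$, $yx=\zeta^txy$, with $y$ grouplike and $x$ being $(y^m,1)$-skew primitive. For a finite-dimensional Hopf algebra $H$ with antipode $S$, the Drinfel'd double $D(H)$ is $H^{*\mathrm{cop}}\otimes H$ as a coalgebra, with unit $\epsilon\otimes1$ and multiplication $$(p\otimes h)(p'\otimes h')=\langle p'_{(1)},S^{-1}(h_{(3)})\rangle\langle p'_{(3)},h_{(1)}\rangle\;p\,p'_{(2)}\otimes h_{(2)}h',$$ where $H^*$ is the dual Hopf algebra (multiplication dual to $\Delta_H$, comultiplication dual to the multiplication of $H$). One writes $p$ for $p\otimes1$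 and $h$ for $\epsilon\otimes h$. Here $y,x$ are the generators of $H=H_n(\zeta,m,t)$, and $Y,X\in H^*$ are the generators of $H^*\cong H_n(\zeta,t,m)$ given on the basis $\{x^ky^\ell\}_{0\le k<N,0\le\ell<n}$ of $H$ by $\langle Y,x^ky^\ell\rangle=\delta_{k,0}\zeta^\ell$ and $\langle X,x^ky^\ell\rangle=\delta_{k,1}$. *)

(* Defs.v *)
From HB Require Import structures.
From mathcomp Require Import all_boot all_order all_algebra all_field.
From mathcomp Require Import monalg.

Set Implicit Arguments.
Unset Strict Implicit.
Unset Printing Implicit Defensive.

Import GRing.Theory.

Local Open Scope ring_scope.

(* Tensor product of finite-dimensional spaces, by coordinates in the bases
   vbasis {:U} and vbasis {:V}.  tlift is its universal property: for a
   bilinear f, tlift (u \tens v) f = f u v (tliftE below).  The definition of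
   tlift makes sense for any f, but it is only meaningful for bilinear ones. *)
Definition tensor (k : fieldType) (U V : vectType k) : Type :=
  'M[k]_(\dim {:U}, \dim {:V}).

HB.instance Definition _ (k : fieldType) (U V : vectType k) :=
  Vector.on (tensor U V).

Definition tens (k : fieldType) (U V : vectType k) (u : U) (v : V) :
    tensor U V :=
  \matrix_(i, j) (coord (vbasis {:U}) i u * coord (vbasis {:V}) j v).

Definition tlift (k : fieldType) (U V : vectType k) (W : lmodType k)
    (w : tensor U V) (f : U -> V -> W) : W :=
  \sum_(i < \dim {:U}) \sum_(j < \dim {:V})
     (w : 'M[k]_(_, _)) i j *: f (vbasis {:U})`_i (vbasis {:V})`_j.

Reserved Notation "u \tens v" (at level 40, left associativity).
Notation "u \tens v" := (tens u v) : ring_scope.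

(* Sweedler notation: \sw_(a, b <- comul h) E is the sum written
   E(h_(1), h_(2)) on paper. *)
Reserved Notation "\sw_ ( a , b <- w ) E"
  (at level 41, E at level 41, a name, b name, w at level 50,
   format "'[' \sw_ ( a ,  b  <-  w ) '/  '  E ']'").
Notation "\sw_ ( a , b <- w ) E" := (tlift w (fun a b => E)) : ring_scope.

Lemma tliftE (k : fieldType) (U V : vectType k) (W : lmodType k)
    (f : U -> V -> W) (u : U) (v : V) :
    (forall b, linear (f^~ b)) -> (forall a, linear (f a)) ->
  tlift (u \tens v) f = f u v.
Proof.
move=> lin1 lin2; set e := vbasis {:U}; set e' := vbasis {:V}.
have fl b (I : finType) (c : I -> k) (g : I -> U) :
    f (\sum_i c i *: g i) b = \sum_i c i *: f (g i) b.
  pose F : {linear U -> W} :=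
    HB.pack (f^~ b) (GRing.isLinear.Build _ _ _ _ (f^~ b) (lin1 b)).
  by rewrite -[LHS]/(F _) linear_sum; apply: eq_bigr => i _; exact: linearZ.
have fr a (I : finType) (c : I -> k) (g : I -> V) :
    f a (\sum_i c i *: g i) = \sum_i c i *: f a (g i).
  pose F : {linear V -> W} :=
    HB.pack (f a) (GRing.isLinear.Build _ _ _ _ (f a) (lin2 a)).
  by rewrite -[LHS]/(F _) linear_sum; apply: eq_bigr => i _; exact: linearZ.
rewrite [in RHS](coord_vbasis (memvf u)) [in RHS](coord_vbasis (memvf v)) fl.
apply: eq_bigr => i _; rewrite fr scaler_sumr; apply: eq_bigr => j _.
by rewrite mxE scalerA.
Qed.

Lemma tlift_is_linear (k : fieldType) (U V : vectType k) (W : lmodType k)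
    (f : U -> V -> W) : linear ((@tlift k U V W)^~ f).
Proof.
move=> a w w'; rewrite /tlift scaler_sumr -big_split; apply: eq_bigr => i _.
rewrite scaler_sumr -big_split; apply: eq_bigr => j _ /=.
by rewrite !mxE scalerDl scalerA.
Qed.

Definition tens_mul (k : fieldType) (A : falgType k) (w w' : tensor A A) :
    tensor A A :=
  \sw_(a, b <- w) \sw_(a', b' <- w') ((a * a') \tens (b * b')).

HB.mixin Record isHopf (k : fieldType) H of Falgebra k H := {
  comul : 'Hom(H, tensor H H);
  counit : 'Hom(H, k^o);
  antipode : 'End(H);
  comulA : forall h : H,
    (\sw_(a, b <- comul h) \sw_(b1, b2 <- comul b) (a \tens (b1 \tens b2)))
    = \sw_(a, b <- comul h) \sw_(a1, a2 <- comul a) (a1 \tens (a2 \tens b));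
  counitl : forall h : H, (\sw_(a, b <- comul h) (counit a *: b)) = h;
  counitr : forall h : H, (\sw_(a, b <- comul h) (counit b *: a)) = h;
  comul1 : comul 1 = (1 : H) \tens (1 : H);
  comulM : forall a b : H, comul (a * b) = tens_mul (comul a) (comul b);
  counit1 : counit 1 = 1;
  counitM : forall a b : H, counit (a * b) = counit a * counit b;
  antipodel : forall h : H,
    (\sw_(a, b <- comul h) (antipode a * b)) = counit h *: 1;
  antipoder : forall h : H,
    (\sw_(a, b <- comul h) (a * antipode b)) = counit h *: 1
}.

#[short(type="hopfAlgType")]
HB.structure Definition Hopf (k : fieldType) :=
  { H of Falgebra k H & isHopf k H }.

(* The antipode of a finite-dimensional Hopf algebra is bijective, so the
   pseudo-inverse of linear maps is its inverse. *)
Definition antipode_inv (k : fieldType) (H : hopfAlgType k) : 'End(H) :=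
  (antipode^-1)%VF.

Definition grouplike (k : fieldType) (C : vectType k)
    (Delta : C -> tensor C C) (eps : C -> k) (g : C) : Prop :=
  Delta g = g \tens g /\ eps g = 1.

Definition skew_primitive (k : fieldType) (C : vectType k)
    (Delta : C -> tensor C C) (eps : C -> k) (g h c : C) : Prop :=
  [/\ grouplike Delta eps g, grouplike Delta eps h
    & Delta c = g \tens c + c \tens h].

Section Dual.
Variables (k : fieldType) (H : hopfAlgType k).

Definition dual_mul (p q : 'Hom(H, k^o)) : 'Hom(H, k^o) :=
  linfun (fun h : H => \sw_(a, b <- comul h) (p a * q b : k^o)).

Definition dual_one : 'Hom(H, k^o) := counit.

Definition dual_vect (i : 'I_(\dim {:H})) : 'Hom(H, k^o) :=
  linfun (fun h : H => coord (vbasis {:H}) i h : k^o).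

(* The transpose of the multiplication of H, see dual_comulE. *)
Definition dual_comul (p : 'Hom(H, k^o)) :
    tensor 'Hom(H, k^o) 'Hom(H, k^o) :=
  \sum_(i < \dim {:H}) \sum_(j < \dim {:H})
    p ((vbasis {:H})`_i * (vbasis {:H})`_j) *: (dual_vect i \tens dual_vect j).

Definition dual_counit (p : 'Hom(H, k^o)) : k := p 1.

Lemma dual_mulE (p q : 'Hom(H, k^o)) (h : H) :
  dual_mul p q h = \sw_(a, b <- comul h) (p a * q b : k^o).
Proof.
have lin : linear (fun h : H => \sw_(a, b <- comul h) (p a * q b : k^o)).
  by move=> c u v; rewrite linearP /= tlift_is_linear.
pose F : {linear H -> k^o} :=
  HB.pack (fun h : H => \sw_(a, b <- comul h) (p a * q b : k^o))
    (GRing.isLinear.Build k H k^o _ _ lin).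
exact: (lfunE F).
Qed.

Lemma dual_vectE i (h : H) : dual_vect i h = coord (vbasis {:H}) i h.
Proof.
have lin : linear (fun h : H => coord (vbasis {:H}) i h : k^o).
  by move=> c u v; rewrite linearP.
pose F : {linear H -> k^o} :=
  HB.pack (fun h : H => coord (vbasis {:H}) i h : k^o)
    (GRing.isLinear.Build k H k^o _ _ lin).
exact: (lfunE F).
Qed.

Lemma dual_comulE (p : 'Hom(H, k^o)) (a b : H) :
  (\sw_(q, r <- dual_comul p) (q a * r b : k^o)) = p (a * b).
Proof.
pose f (q r : 'Hom(H, k^o)) := q a * r b : k^o.
pose F : {linear tensor 'Hom(H, k^o) 'Hom(H, k^o) -> k^o} :=
  HB.pack ((@tlift k _ _ k^o)^~ f)
    (GRing.isLinear.Build k _ k^o _ _ (tlift_is_linear f)).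
rewrite -[LHS]/(F _) /dual_comul linear_sum.
rewrite [in RHS](coord_vbasis (memvf a)) mulr_suml linear_sum.
apply: eq_bigr => i _; rewrite linear_sum.
rewrite [in RHS](coord_vbasis (memvf b)) mulr_sumr linear_sum.
apply: eq_bigr => j _; rewrite linearZ /= tliftE; last first.
- by move=> q c r r'; rewrite /f !lfunE /= lfunE /= mulrDr scalerAr.
- by move=> r c q q'; rewrite /f !lfunE /= lfunE /= mulrDl scalerAl.
rewrite /f !dual_vectE -scalerAr -scalerAl !linearZ /= /GRing.scale /=.
by rewrite mulrA mulrC.
Qed.

End Dual.

(* The Drinfel'd double, with underlying space H^* \tens H.  Only the
   operations are defined here.  In particular double_mul is a bare map: that
   it is associative and unital follows from any presentation of D(H) in the
   sense of presented_by below.  As a coalgebra it is H^{*cop} \tens H, hence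
   the exchange of p1 and p2 in double_comul. *)
Definition drinfeld_double (k : fieldType) (H : hopfAlgType k) : vectType k :=
  tensor 'Hom(H, k^o) H.

Section Double.
Variables (k : fieldType) (H : hopfAlgType k).

Definition double_one : drinfeld_double H := dual_one H \tens (1 : H).

Definition double_mul (w w' : drinfeld_double H) : drinfeld_double H :=
  \sw_(p, h <- w) \sw_(p', h' <- w')
  \sw_(p1, p23 <- dual_comul p') \sw_(p2, p3 <- dual_comul p23)
  \sw_(h1, h23 <- comul h) \sw_(h2, h3 <- comul h23)
    ((p1 (antipode_inv H h3) * p3 h1) *: (dual_mul p p2 \tens (h2 * h'))).

Definition double_exp (w : drinfeld_double H) (i : nat) : drinfeld_double H :=
  iter i (double_mul w) double_one.

Definition double_comul (w : drinfeld_double H) :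
    tensor (drinfeld_double H) (drinfeld_double H) :=
  \sw_(p, h <- w) \sw_(p1, p2 <- dual_comul p) \sw_(h1, h2 <- comul h)
    ((p2 \tens h1 : drinfeld_double H)
      \tens (p1 \tens h2 : drinfeld_double H)).

Definition double_counit (w : drinfeld_double H) : k :=
  \sw_(p, h <- w) (dual_counit p * counit h : k^o).

Definition double_inl (p : 'Hom(H, k^o)) :
    drinfeld_double H := p \tens (1 : H).

Definition double_inr (h : H) : drinfeld_double H := dual_one H \tens h.

End Double.

(* {malg k[{fmonom 'I_d}]} is the free algebra on d generators,
   with basis the words on 'I_d. *)
Notation free_alg k d := {malg k[{fmonom 'I_d}]}.

Definition free_gen (k : fieldType) (d : nat) (i : 'I_d) : free_alg k d :=
  << fmu i >>.

Inductive two_sided_ideal (A : nzRingType) (rels : seq A) : A -> Prop :=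
| ideal_rel a of a \in rels : two_sided_ideal rels a
| ideal_zero : two_sided_ideal rels 0
| ideal_add a b of two_sided_ideal rels a & two_sided_ideal rels b :
    two_sided_ideal rels (a + b)
| ideal_mul a b c of two_sided_ideal rels b : two_sided_ideal rels (a * b * c).

(* The algebra A, with product mul and unit one, is generated by the family g
   subject to the relations r = 0, for r in rels: evaluation at g is an
   isomorphism from the quotient of the free algebra by (rels) onto A. *)
Definition presented_by (k : fieldType) (A : lmodType k) (mul : A -> A -> A)
    (one : A) (d : nat) (g : 'I_d -> A) (rels : seq (free_alg k d)) : Prop :=
  exists phi : {linear free_alg k d -> A},
    [/\ phi 1 = one /\ (forall a b, phi (a * b) = mul (phi a) (phi b)),
        forall i, phi (free_gen k i) = g i,
        forall u, exists a, phi a = u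
      & forall a, phi a = 0 <-> two_sided_ideal rels a].

(* The order of zeta ^+ (m * t), for zeta a primitive n-th root of unity. *)
Definition Hn_order (n m t : nat) : nat := (n %/ gcdn n (m * t))%N.

Definition Hn_rels (k : fieldType) (n m t : nat) (zeta : k) :
    seq (free_alg k 2) :=
  let y := free_gen k (0 : 'I_2) in
  let x := free_gen k (1 : 'I_2) in
  [:: y ^+ n - 1; x ^+ Hn_order n m t; y * x - zeta ^+ t *: (x * y)].

(* H, with generators y and x, is the Hopf algebra H_n(zeta, m, t). *)
Definition is_Hn (k : fieldType) (n m t : nat) (zeta : k) (H : hopfAlgType k)
    (y x : H) : Prop :=
  [/\ presented_by (A := H) *%R 1 (tnth [tuple y; x]) (Hn_rels n m t zeta),
      grouplike (C := H) comul counit y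
    & skew_primitive (C := H) comul counit (y ^+ m) 1 x].

Definition double_rels (k : fieldType) (n m t : nat) (zeta : k) :
    seq (free_alg k 4) :=
  let y := free_gen k (0 : 'I_4) in
  let Y := free_gen k (1 : 'I_4) in
  let x := free_gen k (2 : 'I_4) in
  let X := free_gen k (3 : 'I_4) in
  [:: y ^+ n - 1; Y ^+ n - 1;
      x ^+ Hn_order n m t; X ^+ Hn_order n m t;
      y * x - zeta ^+ t *: (x * y);
      Y * X - zeta ^+ m *: (X * Y);
      y * Y - Y * y;
      x * Y - zeta ^+ m *: (Y * x);
      y * X - zeta ^- t *: (X * y);
      x * X - X * x - (Y ^+ t - y ^+ m)].

(* Main.v *)
From HB Require Import structures.
Require Import Defs.
From mathcomp Require Import all_boot all_order all_algebra all_field.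
From mathcomp Require Import finmap monalg.

(* An element of D(H) = H^* (x) H is viewed as a map H -> H, p (x) h being
   a |-> p(a) h.  In this picture left multiplication by p (x) h is L_p K_h with
   (L_p f)(a) = p(a1) f(a2) and (K_h f)(a) = h2 f(S^-1(h3) a h1).  As H is
   generated by y and x, associativity of the double is only needed for a left
   factor that is one of the four generators, where Delta and S^-1 are explicit.
   So words in the generators act on D(H), which gives a multiplicative map phi
   from the free algebra to D(H).  Modulo the relations every word is a
   combination of the words X^i Y^j x^r y^s with i, r < N and j, s < n; phi maps
   these to X^i Y^j (x) x^r y^s, and these elements form a basis of D(H) because
   <X^i Y^j, x^r y^s> = [i = r] (i)_q! zeta^(js), with q = zeta^(mt). *)

Set Implicit Arguments.
Unset Strict Implicit.
Unset Printing Implicit Defensive.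

Import GRing.Theory.

Local Open Scope ring_scope.

(** * Linear maps and tensors *)

(** The formula for [double_mul] uses [antipode_inv], which by definition is only a pseudo-inverse.
    Before it can be computed, the antipode of H has to be shown antimultiplicative and surjective.
    Both follow by induction along the generators: a convolution argument gives S(uh) for u
    grouplike or skew primitive, and y = S(y^-1), x = S(-x y^-m) exhibit preimages. Linear
    independence of the x^r y^s in H is not read off from the presentation of H either. It comes
    from the prescribed values of X and Y: X acts on functionals as the transpose of a q-derivation
    in x, and the powers of Y are characters of the group generated by y, so the pairing matrix is
    block diagonal, with each block a nonzero multiple of the character table of Z/n. Inverting that
    table uses that n is invertible in k. *)

Definition linear_of (k : fieldType) (U W : lmodType k) (F : U -> W)
    (lF : linear F) : {linear U -> W} :=
  HB.pack F (GRing.isLinear.Build _ _ _ _ F lF).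

Section LinearCombinators.
Variables (k : fieldType) (U : lmodType k).

Lemma lin_id : linear (fun u : U => u).
Proof. by []. Qed.

Lemma lin_comp (V W : lmodType k) (f : V -> W) (g : U -> V) :
  linear f -> linear g -> linear (fun u => f (g u)).
Proof. by move=> lf lg c u v; rewrite lg lf. Qed.

Lemma lin_app (V W : vectType k) (p : 'Hom(V, W)) (f : U -> V) :
  linear f -> linear (fun u => p (f u)).
Proof. by move=> lf c u v; rewrite lf linearP. Qed.

Lemma lin_eval (V W : vectType k) (f : U -> 'Hom(V, W)) a :
  linear f -> linear (fun u => f u a).
Proof. by move=> lf c u v; rewrite lf lfunE /= lfunE. Qed.

Lemma lin_mull (A : algType k) (a : A) (f : U -> A) :
  linear f -> linear (fun u => a * f u).
Proof. by move=> lf c u v; rewrite lf mulrDr scalerAr. Qed.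

Lemma lin_mulr (A : algType k) (a : A) (f : U -> A) :
  linear f -> linear (fun u => f u * a).
Proof. by move=> lf c u v; rewrite lf mulrDl scalerAl. Qed.

Lemma lin_kmull (a : k) (f : U -> k^o) :
  linear f -> linear (fun u => a * f u : k^o).
Proof. exact: (@lin_mull k^o a f). Qed.

Lemma lin_kmulr (a : k) (f : U -> k^o) :
  linear f -> linear (fun u => f u * a : k^o).
Proof. exact: (@lin_mulr k^o a f). Qed.

Lemma lin_scalel (W : lmodType k) (b : W) (f : U -> k^o) :
  linear f -> linear (fun u => f u *: b).
Proof. by move=> lf c u v; rewrite lf scalerDl scalerA. Qed.

Lemma lin_scaler (W : lmodType k) (a : k) (f : U -> W) :
  linear f -> linear (fun u => a *: f u).
Proof. by move=> lf c u v; rewrite lf scalerDr !scalerA mulrC. Qed.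

Lemma lin_add (W : lmodType k) (f g : U -> W) :
  linear f -> linear g -> linear (fun u => f u + g u).
Proof. by move=> lf lg c u v; rewrite lf lg scalerDr addrACA. Qed.

Lemma lin_opp (W : lmodType k) (f : U -> W) :
  linear f -> linear (fun u => - f u).
Proof. by move=> lf c u v; rewrite lf opprD scalerN. Qed.

Lemma lin_tlift (V V' : vectType k) (W : lmodType k) (f : V -> V' -> W)
    (w : U -> tensor V V') :
  linear w -> linear (fun u => tlift (w u) f).
Proof. by move=> lw c u v; rewrite lw tlift_is_linear. Qed.

Lemma lin_tlift_fun (V V' : vectType k) (W : lmodType k)
    (f : U -> V -> V' -> W) (w : tensor V V') :
  (forall a b, linear (fun u => f u a b)) -> linear (fun u => tlift w (f u)).
Proof.
move=> lf c u v; rewrite /tlift scaler_sumr -big_split; apply: eq_bigr => i _.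
rewrite scaler_sumr -big_split; apply: eq_bigr => j _ /=.
by rewrite lf scalerDr !scalerA mulrC.
Qed.

Lemma lin_tensl (V V' : vectType k) (v : V') (f : U -> V) :
  linear f -> linear (fun u => f u \tens v).
Proof.
by move=> lf c a b; apply/matrixP => i j; rewrite !mxE lf linearP mulrDl mulrA.
Qed.

Lemma lin_tensr (V V' : vectType k) (v : V) (f : U -> V') :
  linear f -> linear (fun u => v \tens f u).
Proof.
move=> lf c a b; apply/matrixP => i j; rewrite !mxE lf linearP mulrDr.
by rewrite mulrCA.
Qed.

Lemma lin_bigsum (W : lmodType k) (I : Type) (r : seq I) P (F : I -> U -> W) :
  (forall i, linear (F i)) -> linear (fun u => \sum_(i <- r | P i) F i u).
Proof.
move=> lF c u v; rewrite scaler_sumr -big_split; apply: eq_bigr => i _.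
by rewrite lF.
Qed.

Lemma linZ (W : lmodType k) (f : U -> W) c u : linear f -> f (c *: u) = c *: f u.
Proof. by move=> lf; rewrite -[f]/(linear_of lf : U -> W) linearZ. Qed.

Lemma linD (W : lmodType k) (f : U -> W) u v : linear f -> f (u + v) = f u + f v.
Proof. by move=> lf; rewrite -[f]/(linear_of lf : U -> W) linearD. Qed.

Lemma linN (W : lmodType k) (f : U -> W) u : linear f -> f (- u) = - f u.
Proof. by move=> lf; rewrite -[f]/(linear_of lf : U -> W) linearN. Qed.

Lemma lin0 (W : lmodType k) (f : U -> W) : linear f -> f 0 = 0.
Proof. by move=> lf; rewrite -[f]/(linear_of lf : U -> W) linear0. Qed.

Lemma lin_sum (W : lmodType k) (f : U -> W) (I : Type) (r : seq I) P F :
  linear f -> f (\sum_(i <- r | P i) F i) = \sum_(i <- r | P i) f (F i).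
Proof. by move=> lf; rewrite -[f]/(linear_of lf : U -> W) linear_sum. Qed.

End LinearCombinators.

(** Linearity goals are solved by the head symbol of the body; every Sweedler manipulation through
    [tliftE] produces some. The [bigop] case is matched syntactically because [tlift] itself unfolds
    to a sum. *)
Ltac lin_step :=
  match goal with
  | |- forall _, linear _ => intro
  | |- forall _ _, linear _ => do 2 intro
  | |- _ => first
    [ exact: lin_id | assumption
    | apply: lin_add | apply: lin_opp
    | apply: lin_tensl | apply: lin_tensr
    | apply: lin_kmull | apply: lin_kmulr
    | apply: lin_mull | apply: lin_mulr
    | match goal with |- linear (fun u => bigop _ _ _) => apply: lin_bigsum end
    | apply: lin_scalel | apply: lin_scaler
    | apply: lin_tlift | apply: lin_tlift_fun
    | apply: lin_app | apply: lin_eval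
    | match goal with h : GRing.linear_for _ ?f |- linear (fun u => ?f _) =>
        apply: (lin_comp h) end
    | match goal with
      | h : forall b, GRing.linear_for _ (fun a => ?f a b)
        |- linear (fun u => ?f _ _) => apply: (lin_comp (h _))
      | h : forall a, GRing.linear_for _ (?f a)
        |- linear (fun u => ?f _ _) => apply: (lin_comp (h _))
      end ]
  end.
Ltac lin := repeat lin_step.

Section Tensor.
Variables (k : fieldType) (U V : vectType k).

Lemma eq_tlift (W : lmodType k) (f g : U -> V -> W) (w : tensor U V) :
  (forall a b, f a b = g a b) -> tlift w f = tlift w g.
Proof.
by move=> fg; apply: eq_bigr => i _; apply: eq_bigr => j _; rewrite fg.
Qed.

Lemma tlift_lin (W W' : lmodType k) (F : W -> W') (f : U -> V -> W)
    (w : tensor U V) :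
  linear F -> F (tlift w f) = \sw_(a, b <- w) F (f a b).
Proof.
move=> lF; rewrite -[LHS]/(linear_of lF _) linear_sum; apply: eq_bigr => i _.
by rewrite linear_sum; apply: eq_bigr => j _; rewrite linearZ.
Qed.

Lemma tliftD (W : lmodType k) (f g : U -> V -> W) (w : tensor U V) :
  \sw_(a, b <- w) (f a b + g a b) = tlift w f + tlift w g.
Proof.
rewrite -big_split; apply: eq_bigr => i _; rewrite -big_split.
by apply: eq_bigr => j _; rewrite scalerDr.
Qed.

Lemma tlift0 (W : lmodType k) (w : tensor U V) :
  \sw_(a, b <- w) (0 : W) = 0.
Proof.
by rewrite /tlift big1 // => i _; rewrite big1 // => j _; rewrite scaler0.
Qed.

Lemma tliftDl (W : lmodType k) (f : U -> V -> W) (w w' : tensor U V) :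
  tlift (w + w') f = tlift w f + tlift w' f.
Proof.
by have := tlift_is_linear f 1 w w'; rewrite !scale1r.
Qed.

Lemma tliftZ (W : lmodType k) (f : U -> V -> W) c (w : tensor U V) :
  \sw_(a, b <- w) (c *: f a b) = c *: tlift w f.
Proof. by rewrite (tlift_lin (F := fun u => c *: u)) //; lin. Qed.

Lemma tlift_scale (W : lmodType k) (f : U -> V -> k^o) (x : W) (w : tensor U V) :
  (tlift w f : k) *: x = \sw_(a, b <- w) ((f a b : k) *: x).
Proof. by rewrite (tlift_lin (F := fun c : k^o => (c : k) *: x)) //; lin. Qed.

Lemma exchange_tlift (U' V' : vectType k) (W : lmodType k)
    (f : U -> V -> U' -> V' -> W) (w : tensor U V) (w' : tensor U' V') :
  \sw_(a, b <- w) \sw_(c, d <- w') f a b c d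
  = \sw_(c, d <- w') \sw_(a, b <- w) f a b c d.
Proof.
rewrite /tlift; under eq_bigr => i _.
  under eq_bigr => j _.
    rewrite scaler_sumr; under eq_bigr => i' _ do rewrite scaler_sumr.
    over.
  rewrite exchange_big /=.
  under eq_bigr => i' _ do rewrite exchange_big /=.
  over.
rewrite exchange_big /=; apply: eq_bigr => i' _.
rewrite exchange_big /=; apply: eq_bigr => j' _.
rewrite scaler_sumr; apply: eq_bigr => i _.
rewrite scaler_sumr; apply: eq_bigr => j _.
by rewrite !scalerA mulrC.
Qed.

Lemma tens_vbasis (w : tensor U V) :
  w = \sum_i \sum_j (w : 'M[k]_(_, _)) i j
        *: ((vbasis {:U})`_i \tens (vbasis {:V})`_j).
Proof.
apply/matrixP => i j; rewrite summxE (bigD1 i) //= [X in _ + X]big1 ?addr0.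
  rewrite summxE (bigD1 j) //= [X in _ + X]big1 ?addr0.
    by rewrite !mxE !coord_free ?(basis_free (vbasisP _)) // !eqxx !mulr1.
  move=> l /negbTE lj; rewrite !mxE !coord_free ?(basis_free (vbasisP _)) //.
  by rewrite lj !mulr0.
move=> l /negbTE li; rewrite summxE big1 // => l' _.
by rewrite !mxE coord_free ?(basis_free (vbasisP _)) // li mul0r mulr0.
Qed.

Lemma tensor_ext (W : lmodType k) (F G : tensor U V -> W) w :
  linear F -> linear G -> (forall u v, F (u \tens v) = G (u \tens v)) ->
  F w = G w.
Proof.
move=> lF lG FG.
rewrite -[F w]/(linear_of lF w) -[G w]/(linear_of lG w) (tens_vbasis w) !linear_sum.
apply: eq_bigr => i _; rewrite !linear_sum; apply: eq_bigr => j _.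
by rewrite !linearZ; congr (_ *: _); exact: FG.
Qed.

Lemma tensZl c (u : U) (v : V) : (c *: u) \tens v = c *: (u \tens v).
Proof. by apply/matrixP => i j; rewrite !mxE linearZ /= mulrA. Qed.

Lemma tensZr c (u : U) (v : V) : u \tens (c *: v) = c *: (u \tens v).
Proof. by apply/matrixP => i j; rewrite !mxE linearZ /= mulrCA. Qed.

Lemma tens0l (v : V) : (0 : U) \tens v = 0.
Proof. exact: lin0 (lin_tensl v (@lin_id k U)). Qed.

(** Products of coordinate functionals read off the matrix entries of [w]. *)
Lemma tlift_eq0 (w : tensor U V) :
  (forall (p : 'Hom(U, k^o)) (q : 'Hom(V, k^o)),
    (\sw_(a, b <- w) (p a * q b : k^o)) = 0) -> w = 0.
Proof.
move=> w0; apply/matrixP => i j; rewrite mxE.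
have := w0 (linfun (fun u => coord (vbasis {:U}) i u : k^o))
           (linfun (fun v => coord (vbasis {:V}) j v : k^o)).
set p := linfun _; set q := linfun _ => pq0.
have pE u : p u = coord (vbasis {:U}) i u.
  apply: (lfunE (linear_of (_ : linear (_ : U -> k^o)))) => c u' v.
  by rewrite linearP.
have qE u : q u = coord (vbasis {:V}) j u.
  apply: (lfunE (linear_of (_ : linear (_ : V -> k^o)))) => c u' v.
  by rewrite linearP.
rewrite -[RHS]pq0 /tlift (bigD1 i) //= [X in _ + X]big1 ?addr0.
  rewrite (bigD1 j) //= [X in _ + X]big1 ?addr0.
    rewrite pE qE !coord_free ?(basis_free (vbasisP _)) // !eqxx mulr1.
    by rewrite /GRing.scale /= mulr1.
  move=> l /negbTE lj; rewrite qE coord_free ?(basis_free (vbasisP _)) //.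
  by rewrite lj mulr0 scaler0.
move=> l /negbTE li; rewrite big1 // => l' _.
by rewrite pE coord_free ?(basis_free (vbasisP _)) // li mul0r scaler0.
Qed.

End Tensor.

(** * The double as maps from H to H *)

Section DualLinearity.
Variables (k : fieldType) (H : hopfAlgType k).
Implicit Types (a b h : H) (p q r : 'Hom(H, k^o)).

Lemma lin_dual_mull (U : lmodType k) (q : 'Hom(H, k^o)) f :
  linear f -> linear (fun u : U => dual_mul (f u) q).
Proof.
move=> lf c u v; apply/lfunP => a; rewrite !lfunE /= lfunE /= !dual_mulE lf.
rewrite -(tliftZ _ c) -tliftD; apply: eq_tlift => b d.
by rewrite !lfunE /= lfunE /= mulrDl scalerAl.
Qed.

Lemma lin_dual_mulr (U : lmodType k) (q : 'Hom(H, k^o)) f :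
  linear f -> linear (fun u : U => dual_mul q (f u)).
Proof.
move=> lf c u v; apply/lfunP => a; rewrite !lfunE /= lfunE /= !dual_mulE lf.
rewrite -(tliftZ _ c) -tliftD; apply: eq_tlift => b d.
by rewrite !lfunE /= lfunE /= mulrDr scalerAr.
Qed.

Lemma lin_dual_comul (U : lmodType k) (f : U -> 'Hom(H, k^o)) :
  linear f -> linear (fun u => dual_comul (f u)).
Proof.
move=> lf c u v; rewrite lf /dual_comul scaler_sumr -big_split.
apply: eq_bigr => i _; rewrite scaler_sumr -big_split; apply: eq_bigr => j _.
by rewrite !lfunE /= lfunE /= scalerDl scalerA.
Qed.

End DualLinearity.

Ltac lin ::= repeat first [ lin_step | apply: lin_dual_mull
  | apply: lin_dual_mulr | apply: lin_dual_comul ].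

Section HopfTheory.
Variables (k : fieldType) (H : hopfAlgType k).
Implicit Types (a b h : H) (p q r : 'Hom(H, k^o)).

Lemma sw_comulM (W : lmodType k) (f : H -> H -> W) a b :
  (forall b, linear (f^~ b)) -> (forall a, linear (f a)) ->
  tlift (comul (a * b)) f
  = \sw_(a1, a2 <- comul a) \sw_(b1, b2 <- comul b) f (a1 * b1) (a2 * b2).
Proof.
move=> l1 l2; rewrite comulM /tens_mul.
rewrite (tlift_lin (F := fun w => tlift w f)); last by lin.
apply: eq_tlift => a1 a2.
rewrite (tlift_lin (F := fun w => tlift w f)); last by lin.
by apply: eq_tlift => b1 b2; rewrite tliftE.
Qed.

(** [comulA] is an identity between triple tensors; applying the linear map [F] induced by [f]
    transports it to an arbitrary trilinear [f]. *)
Lemma comul_coassoc (W : lmodType k) (f : H -> H -> H -> W) h :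
  (forall b c, linear (fun a => f a b c)) ->
  (forall a c, linear (fun b => f a b c)) ->
  (forall a b, linear (f a b)) ->
  \sw_(a, b <- comul h) \sw_(b1, b2 <- comul b) f a b1 b2
  = \sw_(a, b <- comul h) \sw_(a1, a2 <- comul a) f a1 a2 b.
Proof.
move=> l1 l2 l3; pose F (w : tensor H (tensor H H)) :=
  \sw_(a, v <- w) tlift v (f a).
have lF : linear F by rewrite /F; lin.
have FE a b c : F (a \tens (b \tens c)) = f a b c.
  by rewrite /F tliftE ?tliftE //; lin.
have := congr1 F (comulA h); rewrite (tlift_lin _ _ lF) (tlift_lin _ _ lF).
under eq_tlift => a b.
  rewrite (tlift_lin _ _ lF); under eq_tlift => b1 b2 do rewrite FE.
  over.
move=> ->; apply: eq_tlift => a b; rewrite (tlift_lin _ _ lF).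
by apply: eq_tlift => a1 a2; rewrite FE.
Qed.

(* Sum V(h1) h2 S(h3) is both V(h) and 0. *)
Lemma convolution_cancelr (V : H -> H) :
  linear V -> (forall h, (\sw_(a, b <- comul h) (V a * b)) = 0) ->
  forall h, V h = 0.
Proof.
move=> lV V0 h.
have: (\sw_(a, b <- comul h) \sw_(b1, b2 <- comul b)
         (V a * (b1 * antipode b2))) = V h.
  rewrite -[in RHS](counitr h) (tlift_lin _ _ lV); apply: eq_tlift => a b.
  rewrite -(tlift_lin _ _ (lin_mull (V a) (@lin_id _ _))) antipoder -scalerAr.
  by rewrite mulr1 (linZ _ _ lV).
rewrite (comul_coassoc (f := fun a b c => V a * (b * antipode c))); try by lin.
move=> <-; rewrite -[RHS](tlift0 _ (comul h)); apply: eq_tlift => a b.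
under eq_tlift => a1 a2 do rewrite mulrA.
by rewrite -(tlift_lin _ _ (lin_mulr (antipode b) (@lin_id _ _))) V0 mul0r.
Qed.

Definition ev (w : drinfeld_double H) (a : H) : H :=
  \sw_(p, h <- w) ((p a : k) *: h).

Definition Lop (p : 'Hom(H, k^o)) (psi : H -> H) (a : H) : H :=
  \sw_(a1, a2 <- comul a) ((p a1 : k) *: psi a2).

Definition Kop (h : H) (psi : H -> H) (a : H) : H :=
  \sw_(h1, h23 <- comul h) \sw_(h2, h3 <- comul h23)
    (h2 * psi (antipode_inv H h3 * a * h1)).

Lemma lin_evl a : linear (ev^~ a).
Proof. by rewrite /ev; lin. Qed.

Lemma lin_evr w : linear (ev w).
Proof. by rewrite /ev; lin. Qed.

Lemma ev_tens p h a : ev (p \tens h) a = (p a : k) *: h.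
Proof. by rewrite /ev tliftE //; lin. Qed.

(** Contracting the H factor of a tensor by [q] leaves a functional whose value at [a] is
    [q (ev w a)]. If [ev w] vanishes, so does this functional, hence every pairing of [w] with a
    product of functionals. *)
Lemma ev_inj w w' : ev w =1 ev w' -> w = w'.
Proof.
move=> eww'; apply/eqP; rewrite -subr_eq0; apply/eqP/tlift_eq0 => p q.
have {eww'} w0 a : ev (w - w') a = 0.
  by rewrite (linD _ _ (lin_evl a)) (linN _ (lin_evl a)) eww' subrr.
have: p (\sw_(f, h <- w - w') ((q h : k) *: f)) = 0.
  rewrite (_ : tlift _ _ = 0) ?linear0 //; apply/lfunP => a.
  rewrite (tlift_lin (F := fun f : 'Hom(H, k^o) => f a)); last by lin.
  transitivity (q (ev (w - w') a)); last by rewrite w0 linear0 lfunE.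
  rewrite /ev (tlift_lin (F := q)); last by lin.
  by apply: eq_tlift => f h; rewrite linearZ lfunE; exact: mulrC.
rewrite (tlift_lin (F := p)) => [<-|]; last by lin.
by apply: eq_tlift => f h; rewrite linearZ; exact: mulrC.
Qed.

(** This makes [dual_comul] computable: together with [dual_comulE] it turns an equation for
    [dual_comul p] into a formula for [p (a * b)]. *)
Lemma dual_tensor_inj (w w' : tensor 'Hom(H, k^o) 'Hom(H, k^o)) :
  (forall a b, (\sw_(q, r <- w) (q a * r b : k^o)) = \sw_(q, r <- w') (q a * r b)) ->
  w = w'.
Proof.
move=> eww'; apply/eqP; rewrite -subr_eq0; apply/eqP/tlift_eq0 => p q.
have {eww'} w0 a b : (\sw_(q, r <- w - w') (q a * r b : k^o)) = 0.
  by rewrite (linD _ _ (tlift_is_linear _)) (linN _ (tlift_is_linear _)) eww' subrr.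
have {}w0 b : (\sw_(q, r <- w - w') ((r b : k) *: q)) = 0.
  apply/lfunP => a.
  rewrite (tlift_lin (F := fun f : 'Hom(H, k^o) => f a)); last by lin.
  rewrite lfunE -[RHS](w0 a b); apply: eq_tlift => f h.
  by rewrite lfunE; exact: mulrC.
have {}w0 : (\sw_(q, r <- w - w') ((p q : k) *: r)) = 0.
  apply/lfunP => a.
  rewrite (tlift_lin (F := fun f : 'Hom(H, k^o) => f a)); last by lin.
  transitivity (p (\sw_(q, r <- w - w') ((r a : k) *: q))); last first.
    by rewrite w0 linear0 lfunE.
  rewrite (tlift_lin (F := p)); last by lin.
  by apply: eq_tlift => f h; rewrite linearZ lfunE; exact: mulrC.
transitivity (q (\sw_(q, r <- w - w') ((p q : k) *: r))); last first.
  by rewrite w0 linear0.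
rewrite (tlift_lin (F := q)); last by lin.
by apply: eq_tlift => f h; rewrite linearZ.
Qed.

Lemma lin_Lop (U : lmodType k) p (psi : U -> H -> H) a :
  (forall b, linear (fun u => psi u b)) -> linear (fun u => Lop p (psi u) a).
Proof. by move=> l; rewrite /Lop; lin. Qed.

Lemma lin_Kop (U : lmodType k) h (psi : U -> H -> H) a :
  (forall b, linear (fun u => psi u b)) -> linear (fun u => Kop h (psi u) a).
Proof. by move=> l; rewrite /Kop; lin. Qed.

Lemma eq_Lop p f g : f =1 g -> Lop p f =1 Lop p g.
Proof. by move=> fg a; apply: eq_tlift => b c; rewrite fg. Qed.

Lemma eq_Kop h f g : f =1 g -> Kop h f =1 Kop h g.
Proof.
by move=> fg a; apply: eq_tlift => b c; apply: eq_tlift => d e; rewrite fg.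
Qed.

Lemma dual_comul3 p u b v :
  (\sw_(p1, p23 <- dual_comul p) \sw_(p2, p3 <- dual_comul p23)
    (p1 u * p2 b * p3 v : k^o)) = p (u * b * v).
Proof.
rewrite -mulrA -dual_comulE; apply: eq_tlift => r s.
rewrite -dual_comulE (tlift_lin (F := fun c : k^o => r u * c : k^o)); last by lin.
by apply: eq_tlift => r' s'; rewrite mulrA.
Qed.

(** Evaluation at [a] spreads the product of [p] and p'_(2) over [comul a], after which the three
    legs of p' recombine into the single value p'(S^-1(h3) a2 h1). The multiplication of the double
    thus becomes a composition of operators. *)
Lemma ev_mul p h w a :
  ev (double_mul (p \tens h) w) a = Lop p (Kop h (ev w)) a.
Proof.
rewrite /double_mul tliftE; [| by lin..].
set Q := (Q in tlift w Q).
apply: (tensor_ext (F := fun w => ev (tlift w Q) a)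
                   (G := fun w => Lop p (Kop h (ev w)) a)).
- by apply: (lin_comp (lin_evl a)); lin.
- by apply: lin_Lop => b; apply: lin_Kop => c; exact: lin_evl.
move=> p' h'; rewrite tliftE; [| by rewrite /Q; lin..]; rewrite /Q.
rewrite !(tlift_lin _ _ (lin_evl a)).
(* The sums over [comul h] are brought outside those over [dual_comul p'], which can then be
   collapsed by [dual_comul3]. *)
under eq_tlift => p1 p23.
  rewrite (tlift_lin _ _ (lin_evl a)).
  under eq_tlift => p2 p3.
    rewrite (tlift_lin _ _ (lin_evl a)).
    under eq_tlift => h1 h23.
      rewrite (tlift_lin _ _ (lin_evl a)).
      under eq_tlift => h2 h3 do rewrite (linZ _ _ (lin_evl a)) ev_tens scalerA.
      over.
    over.
  rewrite exchange_tlift; under eq_tlift do rewrite exchange_tlift.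
  over.
rewrite exchange_tlift; under eq_tlift do rewrite exchange_tlift.
transitivity (\sw_(h1, h23 <- comul h) \sw_(h2, h3 <- comul h23)
   \sw_(a1, a2 <- comul a)
    ((p a1 * p' (antipode_inv H h3 * a2 * h1) : k) *: (h2 * h'))).
  apply: eq_tlift => h1 h23; apply: eq_tlift => h2 h3.
  transitivity (\sw_(p1, p23 <- dual_comul p') \sw_(p2, p3 <- dual_comul p23)
     \sw_(a1, a2 <- comul a)
      ((p a1 * (p1 (antipode_inv H h3) * p2 a2 * p3 h1) : k) *: (h2 * h'))).
    apply: eq_tlift => p1 p23; apply: eq_tlift => p2 p3.
    rewrite dual_mulE -scalerA tlift_scale.
    rewrite -tliftZ; apply: eq_tlift => a1 a2; rewrite scalerA; congr (_ *: _).
    rewrite mulrCA; congr (_ * _); exact: mulrAC.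
  under eq_tlift do rewrite exchange_tlift.
  rewrite exchange_tlift; apply: eq_tlift => a1 a2; rewrite -dual_comul3.
  rewrite -scalerA tlift_scale.
  rewrite -tliftZ; apply: eq_tlift => p1 p23.
  rewrite tlift_scale.
  by rewrite -tliftZ; apply: eq_tlift => p2 p3; rewrite scalerA.
under eq_tlift do rewrite exchange_tlift.
rewrite exchange_tlift; apply: eq_tlift => a1 a2.
rewrite /Kop -tliftZ; apply: eq_tlift => h1 h23.
rewrite -tliftZ; apply: eq_tlift => h2 h3.
by rewrite ev_tens -scalerAr scalerA.
Qed.
End HopfTheory.

(** * Left multiplication by grouplike and skew-primitive elements *)

Section DoubleTheory.
Variables (k : fieldType) (H : hopfAlgType k).
Implicit Types (a b h : H) (p q r : 'Hom(H, k^o)) (u v w : drinfeld_double H).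

Lemma lin_double_mull (U : lmodType k) v (f : U -> drinfeld_double H) :
  linear f -> linear (fun c => double_mul (f c) v).
Proof. by move=> lf; apply: lin_tlift. Qed.

Lemma lin_double_mulr (U : lmodType k) v (f : U -> drinfeld_double H) :
  linear f -> linear (fun c => double_mul v (f c)).
Proof. by move=> lf; apply: lin_tlift_fun => p h; apply: lin_tlift. Qed.

Lemma Lop_linear p psi : linear psi -> linear (Lop p psi).
Proof. by move=> lpsi; rewrite /Lop; lin. Qed.

Lemma Kop_linear h psi : linear psi -> linear (Kop h psi).
Proof. by move=> lpsi; rewrite /Kop; lin. Qed.

Lemma Lop_counit psi : linear psi -> Lop (dual_one H) psi =1 psi.
Proof.
move=> lpsi a; rewrite -[in RHS](counitl a) (tlift_lin _ _ lpsi).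
by apply: eq_tlift => b c; rewrite (linZ _ _ lpsi).
Qed.

Lemma Lop_mul p q psi :
  linear psi -> Lop (dual_mul p q) psi =1 Lop p (Lop q psi).
Proof.
move=> lpsi a; rewrite /Lop.
transitivity (\sw_(a1, a2 <- comul a) \sw_(b1, b2 <- comul a2)
               ((p a1 * q b1 : k) *: psi b2)).
  rewrite (comul_coassoc (f := fun a b c => (p a * q b : k) *: psi c)); try by lin.
  by apply: eq_tlift => a1 a2; rewrite dual_mulE tlift_scale.
apply: eq_tlift => a1 a2; rewrite -tliftZ; apply: eq_tlift => b1 b2.
by rewrite scalerA.
Qed.

(** The two-sided coregular action of H on its dual; elements of H pass functionals through it. *)
Definition twist a b p : 'Hom(H, k^o) := (p \o (amulr b \o amull a))%VF.

Lemma twistE a b p h : twist a b p h = p (a * h * b).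
Proof. by rewrite /twist !comp_lfunE !lfunE. Qed.

Lemma counit_twist a b : twist a b counit = (counit a * counit b) *: dual_one H.
Proof.
by apply/lfunP => h; rewrite twistE lfunE /= !counitM mulrAC.
Qed.

Section Grouplike.
Variables u ui : H.
Hypothesis Ku : u * ui = 1.
Hypotheses (Du : comul u = u \tens u) (eu : counit u = 1).
Hypotheses (Dui : comul ui = ui \tens ui).

Lemma sw_glikel (W : lmodType k) (f : H -> H -> W) h :
  (forall b, linear (f^~ b)) -> (forall a, linear (f a)) ->
  tlift (comul (u * h)) f = \sw_(a, b <- comul h) f (u * a) (u * b).
Proof. by move=> l1 l2; rewrite sw_comulM // Du tliftE //; lin. Qed.

Lemma sw_gliker (W : lmodType k) (f : H -> H -> W) h :
  (forall b, linear (f^~ b)) -> (forall a, linear (f a)) ->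
  tlift (comul (h * u)) f = \sw_(a, b <- comul h) f (a * u) (b * u).
Proof.
move=> l1 l2; rewrite sw_comulM //; apply: eq_tlift => a b.
by rewrite Du tliftE //; lin.
Qed.

(** The maps sending h to S(uh)u and to S(h) have the same convolution with the identity, since
    counit(uh) = counit(h), so [convolution_cancelr] identifies them. *)
Lemma antipode_glikel h : antipode (u * h) = antipode h * ui.
Proof.
suff e : antipode (u * h) * u = antipode h by rewrite -e -mulrA Ku mulr1.
apply/eqP; rewrite -subr_eq0; apply/eqP.
apply: (convolution_cancelr (V := fun h => antipode (u * h) * u - antipode h)).
  by lin.
move=> {}h; under eq_tlift => a b do rewrite mulrBl -mulrA.
have := antipodel (u * h).
rewrite sw_glikel ?counitM ?eu ?mul1r; try by lin.
rewrite tliftD => ->.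
under eq_tlift do rewrite -mulN1r.
rewrite -(tlift_lin _ _ (lin_mull (- 1) (@lin_id _ _))) antipodel mulN1r.
by rewrite subrr.
Qed.

Lemma Kop_glike psi a : linear psi -> antipode_inv H u = ui ->
  Kop u psi a = u * psi (ui * a * u).
Proof.
move=> lpsi Su; rewrite /Kop Du tliftE; try by lin.
by rewrite Du tliftE ?Su; try by lin.
Qed.

Lemma Kop_glike_mul h psi a : linear psi ->
  antipode_inv H u = ui ->
  (forall b, antipode_inv H (u * b) = antipode_inv H b * ui) ->
  Kop (u * h) psi a = Kop u (Kop h psi) a.
Proof.
move=> lpsi Su SM; rewrite Kop_glike //; last exact: Kop_linear.
rewrite /Kop sw_glikel; try by lin.
rewrite (tlift_lin _ _ (lin_mull u (@lin_id _ _))); apply: eq_tlift => b c.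
rewrite sw_glikel; try by lin.
rewrite (tlift_lin _ _ (lin_mull u (@lin_id _ _))); apply: eq_tlift => d e.
by rewrite SM !mulrA.
Qed.

(** Conjugation by a grouplike element is a coalgebra map, so it acts on both legs of [comul a]
    separately; the first leg goes into [p]. *)
Lemma Kop_glike_Lop p psi a : linear psi -> antipode_inv H u = ui ->
  Kop u (Lop p psi) a = Lop (twist ui u p) (Kop u psi) a.
Proof.
move=> lpsi Su; rewrite Kop_glike //; last exact: Lop_linear.
rewrite /Lop sw_gliker; try by lin.
rewrite sw_comulM; try by lin.
rewrite Dui tliftE; try by lin.
rewrite (tlift_lin _ _ (lin_mull u (@lin_id _ _))); apply: eq_tlift => b c.
by rewrite Kop_glike // twistE -scalerAr.
Qed.

Lemma double_mul_glike p h : antipode_inv H u = ui ->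
  double_mul (double_inr u) (p \tens h) = twist ui u p \tens (u * h).
Proof.
move=> Su; apply: ev_inj => a; rewrite ev_mul Lop_counit.
  by rewrite Kop_glike ?ev_tens ?twistE ?scalerAr //; exact: lin_evr.
by apply: Kop_linear; exact: lin_evr.
Qed.

(** On [v = p \tens h] this is the operator identity K_u L_p K_h = L_p' K_(uh) with
    [p' = twist ui u p]. *)
Lemma double_mulA_glike v w :
  antipode_inv H u = ui ->
  (forall b, antipode_inv H (u * b) = antipode_inv H b * ui) ->
  double_mul (double_inr u) (double_mul v w)
  = double_mul (double_mul (double_inr u) v) w.
Proof.
move=> Su SM.
apply: (tensor_ext (F := fun v => double_mul _ (double_mul v w))
                   (G := fun v => double_mul (double_mul _ v) w)).
- by apply: lin_double_mulr; apply: lin_double_mull; lin.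
- by apply: lin_double_mull; apply: lin_double_mulr; lin.
move=> p h; apply: ev_inj => a; rewrite double_mul_glike // !ev_mul.
have lw := lin_evr w; have lK := Kop_linear h lw.
rewrite Lop_counit; last by apply: Kop_linear; exact: lin_evr.
rewrite (eq_Kop _ (g := Lop p (Kop h (ev w)))); last by move=> b; exact: ev_mul.
rewrite Kop_glike_Lop //; apply: eq_Lop => b.
by rewrite Kop_glike_mul.
Qed.

End Grouplike.

Section SkewPrimitive.
Variables g gi x : H.
Hypothesis Kg : g * gi = 1.
Hypotheses (Dg : comul g = g \tens g) (eg : counit g = 1).
Hypotheses (Dgi : comul gi = gi \tens gi) (Dx : comul x = g \tens x + x \tens 1).
Hypothesis (ex : counit x = 0).

Lemma sw_skewl (W : lmodType k) (f : H -> H -> W) h :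
  (forall b, linear (f^~ b)) -> (forall a, linear (f a)) ->
  tlift (comul (x * h)) f
  = \sw_(a, b <- comul h) (f (g * a) (x * b) + f (x * a) b).
Proof.
move=> l1 l2; rewrite sw_comulM // Dx tliftDl !tliftE; try by lin.
rewrite -tliftD; apply: eq_tlift => a b; by rewrite mul1r.
Qed.

Lemma sw_skewr (W : lmodType k) (f : H -> H -> W) h :
  (forall b, linear (f^~ b)) -> (forall a, linear (f a)) ->
  tlift (comul (h * x)) f
  = \sw_(a, b <- comul h) (f (a * g) (b * x) + f (a * x) b).
Proof.
move=> l1 l2; rewrite sw_comulM //; apply: eq_tlift => a b.
by rewrite Dx tliftDl !tliftE ?mulr1; try by lin.
Qed.

(** The antipode axiom at xh reads S(g h1) x h2 + S(x h1) h2 = 0, and S(g h1) = S(h1) g^-1 by the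
    grouplike case. So the difference of both sides has zero convolution with the identity. *)
Lemma antipode_skewl h : antipode (x * h) = - antipode h * gi * x.
Proof.
apply/eqP; rewrite -subr_eq0; apply/eqP.
apply: (convolution_cancelr
  (V := fun h => antipode (x * h) - - antipode h * gi * x)).
  by lin.
move=> {}h; have := antipodel (x * h).
rewrite sw_skewl ?counitM ?ex ?mul0r ?scale0r; try by lin.
move=> e0; rewrite -[RHS]e0; apply: eq_tlift => a b.
rewrite (antipode_glikel Kg Dg eg) mulrBl !mulNr opprK addrC.
by rewrite !mulrA.
Qed.

Hypothesis Sx : antipode_inv H x = - (x * gi).
Hypothesis Sg : antipode_inv H g = gi.
Hypothesis S1 : antipode_inv H 1 = 1.

(** The iterated coproduct of x has the three terms g, g, x and g, x, 1 and x, 1, 1, with S^-1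
    applied to the last leg. *)
Lemma Kop_skew psi a : linear psi ->
  Kop x psi a = - (g * psi (x * gi * a * g)) + x * psi (a * g) + psi (a * x).
Proof.
move=> lpsi; rewrite /Kop Dx tliftDl !tliftE; try by lin.
rewrite Dx tliftDl !tliftE ?comul1 ?tliftE; try by lin.
by rewrite Sx S1 !mul1r !mulNr (linN _ lpsi) mulrN.
Qed.

Hypothesis SxM : forall b,
  antipode_inv H (x * b) = antipode_inv H b * antipode_inv H x.
Hypothesis SgM : forall b, antipode_inv H (g * b) = antipode_inv H b * gi.

Lemma Kop_skew_mul h psi a : linear psi ->
  Kop (x * h) psi a = Kop x (Kop h psi) a.
Proof.
move=> lpsi; rewrite Kop_skew //; last exact: Kop_linear.
rewrite /Kop sw_skewl; try by lin.
rewrite tliftD; congr (_ + _); last first.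
  apply: eq_tlift => b c; apply: eq_tlift => d e.
  by rewrite !mulrA.
rewrite -mulNr (tlift_lin _ _ (lin_mull x (@lin_id _ _))).
rewrite (tlift_lin _ _ (lin_mull (- g) (@lin_id _ _))).
rewrite -tliftD; apply: eq_tlift => b c.
rewrite sw_skewl; try by lin.
rewrite tliftD; congr (_ + _).
  rewrite (tlift_lin _ _ (lin_mull (- g) (@lin_id _ _))).
  apply: eq_tlift => d e.
  by rewrite SxM Sx mulrN !mulNr (linN _ lpsi) mulrN !mulrA.
rewrite (tlift_lin _ _ (lin_mull x (@lin_id _ _))).
by apply: eq_tlift => d e; rewrite !mulrA.
Qed.

(** Splitting the three arguments of [Kop_skew] over [comul a] gives five terms. The three in which
    [p] sees [b * g] reassemble into K_x psi; the other two are those in which the first leg takes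
    x, in [x * gi * b * g] and in [b * x]. *)
Lemma Kop_skew_Lop p psi a : linear psi ->
  Kop x (Lop p psi) a =
  - Lop (twist (x * gi) g p) (Kop g psi) a + Lop (twist 1 g p) (Kop x psi) a
  + Lop (twist 1 x p) psi a.
Proof.
move=> lpsi; rewrite Kop_skew //; last exact: Lop_linear.
pose f b c := (p b : k) *: psi c.
have e1 : Lop p psi (x * gi * a * g)
    = \sw_(b, c <- comul a) (f (b * g) (x * gi * c * g)
                             + f (x * gi * b * g) (gi * c * g)).
  rewrite /Lop (sw_gliker Dg); try by lin.
  rewrite -!mulrA sw_skewl; try by lin.
  rewrite (sw_glikel Dgi); try by lin.
  apply: eq_tlift => b c; rewrite /f !mulrA Kg mul1r.
  congr (_ *: psi _ + _ *: psi _);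
  by rewrite ?mulrA.
have e2 : Lop p psi (a * g) = \sw_(b, c <- comul a) f (b * g) (c * g).
  by rewrite /Lop (sw_gliker Dg) //; lin.
have e3 : Lop p psi (a * x)
    = \sw_(b, c <- comul a) (f (b * g) (c * x) + f (b * x) c).
  by rewrite /Lop sw_skewr //; lin.
rewrite e1 e2 e3 -mulNr (tlift_lin _ _ (lin_mull x (@lin_id _ _))).
rewrite (tlift_lin _ _ (lin_mull (- g) (@lin_id _ _))) -!tliftD.
rewrite -[X in _ = X + _ + _]scaleN1r -tliftZ -!tliftD; apply: eq_tlift => b c.
rewrite (Kop_glike Dg _ lpsi Sg) Kop_skew // !twistE !mul1r /f scaleN1r.
rewrite !scalerDr !scalerN mulrDr !mulNr -!scalerAr.
by rewrite !addrA; congr (_ + _ + _ + _); exact: addrC.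
Qed.

Lemma double_mul_skew p h :
  double_mul (double_inr x) (p \tens h) =
  - (twist (x * gi) g p \tens (g * h)) + twist 1 g p \tens (x * h)
  + twist 1 x p \tens h.
Proof.
apply: ev_inj => a; rewrite ev_mul Lop_counit; last first.
  by apply: Kop_linear; exact: lin_evr.
have l := lin_evl a; rewrite Kop_skew; last exact: lin_evr.
rewrite !(linD _ _ l) (linN _ l) !ev_tens !twistE !mul1r.
by rewrite !scalerAr.
Qed.

Lemma double_mulA_skew v w :
  double_mul (double_inr x) (double_mul v w)
  = double_mul (double_mul (double_inr x) v) w.
Proof.
apply: (tensor_ext (F := fun v => double_mul _ (double_mul v w))
                   (G := fun v => double_mul (double_mul _ v) w)).
- by apply: lin_double_mulr; apply: lin_double_mull; lin.
- by apply: lin_double_mull; apply: lin_double_mulr; lin.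
move=> p h; apply: ev_inj => a; rewrite double_mul_skew // !ev_mul.
have lw := lin_evr w; have lK := Kop_linear h lw.
rewrite Lop_counit; last by apply: Kop_linear; exact: lin_evr.
rewrite (eq_Kop _ (g := Lop p (Kop h (ev w)))); last by move=> b; exact: ev_mul.
have l : linear (fun v => ev (double_mul v w) a).
  by apply: (lin_comp (lin_evl a)); apply: lin_double_mull; lin.
rewrite !(linD _ _ l) (linN _ l) !ev_mul Kop_skew_Lop //; congr (- _ + _ + _).
  by apply: eq_Lop => b; rewrite (Kop_glike_mul (ui := gi) Dg).
by apply: eq_Lop => b; rewrite Kop_skew_mul.
Qed.

End SkewPrimitive.

Lemma Kop1 psi a : linear psi -> antipode_inv H 1 = 1 -> Kop 1 psi a = psi a.
Proof.
move=> lpsi S1.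
by rewrite (Kop_glike (ui := 1) (comul1 : comul 1 = _)) // mulr1 !mul1r.
Qed.

Lemma double_mul_inl q p h : antipode_inv H 1 = 1 ->
  double_mul (double_inl q) (p \tens h) = dual_mul q p \tens h.
Proof.
move=> S1; apply: ev_inj => a; rewrite ev_mul ev_tens dual_mulE tlift_scale.
apply: eq_tlift => b c; rewrite Kop1 // ?ev_tens ?scalerA //; exact: lin_evr.
Qed.

Lemma double_mulA_inl q v w : antipode_inv H 1 = 1 ->
  double_mul (double_inl q) (double_mul v w)
  = double_mul (double_mul (double_inl q) v) w.
Proof.
move=> S1.
apply: (tensor_ext (F := fun v => double_mul _ (double_mul v w))
                   (G := fun v => double_mul (double_mul _ v) w)).
- by apply: lin_double_mulr; apply: lin_double_mull; lin.
- by apply: lin_double_mull; apply: lin_double_mulr; lin.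
move=> p h; apply: ev_inj => a; rewrite double_mul_inl // !ev_mul.
have lw := lin_evr w; have lK := Kop_linear h lw.
rewrite Lop_mul //; apply: eq_Lop => b; rewrite Kop1 ?ev_mul //.
exact: lin_evr.
Qed.

Lemma double_mul1 v : antipode_inv H 1 = 1 -> double_mul (double_one H) v = v.
Proof.
move=> S1; apply: ev_inj => a; rewrite ev_mul Lop_counit.
  by rewrite Kop1 //; exact: lin_evr.
by apply: Kop_linear; exact: lin_evr.
Qed.

End DoubleTheory.

(** * Evaluation on the free algebra *)

Section Multiplicativity.
Variables (k : fieldType) (F : lalgType k) (I : Type) (gen : I -> F).
Hypothesis F_ind : forall P : F -> Prop,
    P 1 -> (forall i a, P a -> P (gen i * a)) ->
    (forall c a b, P a -> P b -> P (c *: a + b)) ->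
  forall a, P a.
Variables (A : lmodType k) (mul : A -> A -> A) (one : A) (g : I -> A).
Hypotheses (mull : forall v, linear (mul^~ v)) (mulr : forall u, linear (mul u)).
Hypothesis mul1 : forall v, mul one v = v.
Hypothesis mulgA : forall i u v, mul (g i) (mul u v) = mul (mul (g i) u) v.
Variable phi : F -> A.
Hypotheses (lphi : linear phi) (phi1 : phi 1 = one).
Hypothesis phi_genM : forall i a, phi (gen i * a) = mul (g i) (phi a).

Lemma eval_multiplicative a b : phi (a * b) = mul (phi a) (phi b).
Proof.
elim/F_ind: a => [|i a IH|c a a' IH IH'].
- by rewrite mul1r phi1 mul1.
- by rewrite -mulrA !phi_genM IH mulgA.
by rewrite mulrDl -scalerAl !lphi IH IH' mull.
Qed.

Lemma eval_gen i : mul (g i) one = g i -> phi (gen i) = g i.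
Proof. by rewrite -[in phi _](mulr1 (gen i)) phi_genM phi1. Qed.

(* A family M spanning F modulo rels whose image in A is a basis witnesses that
   no relation is missing. *)
Lemma eval_kernel (rels : seq F) (J : finType) (M : J -> F) :
    {in rels, forall a, phi a = 0} ->
    (forall a, exists c : J -> k,
       two_sided_ideal rels (a - \sum_i c i *: M i)) ->
    (forall c : J -> k, \sum_i c i *: phi (M i) = 0 -> forall i, c i = 0) ->
  forall a, phi a = 0 <-> two_sided_ideal rels a.
Proof.
move=> rel0 Mspan Mfree.
have ideal0 a : two_sided_ideal rels a -> phi a = 0.
  elim=> {a} [a /rel0 //||a b _ pa _ pb|a b c _ pb]; first exact: lin0.
    by rewrite (linD _ _ lphi) pa pb addr0.
  rewrite !eval_multiplicative pb (lin0 (mulr _)); exact: (lin0 (mull _)).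
move=> a; split; last exact: ideal0.
move=> a0; have [c Hc] := Mspan a; have := ideal0 _ Hc.
rewrite (linD _ _ lphi) (linN _ lphi) (lin_sum _ _ _ lphi) a0 sub0r.
move/eqP; rewrite oppr_eq0 => /eqP c0.
have {}c0 : forall i, c i = 0.
  by apply: Mfree; rewrite -[RHS]c0; apply: eq_bigr => i _; rewrite (linZ _ _ lphi).
by move: Hc; rewrite big1 ?subr0 // => i _; rewrite c0 scale0r.
Qed.

End Multiplicativity.

Section FreeAlgebra.
Variables (k : fieldType) (d : nat).
Local Notation F := (free_alg k d).
Implicit Types (a b : F) (c : k) (w : {fmonom 'I_d}).

Lemma scale_monom c w : c *: << w >> = << c *g w >> :> F.
Proof.
apply: (proj1 (malgP _ _)) => v.
rewrite (mcoeffZ c << w >> v) mcoeffU1.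
by rewrite mcoeffU mulr_natr.
Qed.

Lemma monom1 : << (mone : {fmonom 'I_d}) >> = 1 :> F.
Proof. by []. Qed.

Lemma monom_cons i (s : seq 'I_d) :
  << FMonom (i :: s) >> = free_gen k i * << FMonom s >> :> F.
Proof.
rewrite malgM_def fgmulUU mulr1; congr << 1 *g _ >>; apply: val_inj => /=.
by rewrite fmM fmU.
Qed.

Lemma free_scalerAr c a b : c *: (a * b) = a * (c *: b).
Proof.
apply: (proj1 (malgP _ _)) => w.
rewrite (mcoeffZ c (a * b) w) (mcoeffMl a b w).
rewrite (mcoeffMlw w (fsubset_refl (msupp a)) (msuppZ_le c b)) mulr_sumr.
apply: eq_bigr => w1 _; rewrite mulr_sumr; apply: eq_bigr => w2 _.
by rewrite (mcoeffZ c b w2) mulrnAr mulrCA.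
Qed.

Lemma free_alg_ind (P : F -> Prop) :
    P 1 -> (forall i a, P a -> P (free_gen k i * a)) ->
    (forall c a b, P a -> P b -> P (c *: a + b)) ->
  forall a, P a.
Proof.
move=> P1 PM PD a.
have P0 : P 0 by have := PD (- 1) _ _ P1 P1; rewrite scaleN1r addNr.
rewrite (monalgE a); elim: (X in \sum_(_ <- X) _) => [|w s IH].
  by rewrite big_nil.
rewrite big_cons -scale_monom; apply: PD => //.
case: w => s'; elim: s' => [|i s' IH']; last by rewrite monom_cons; exact: PM.
by rewrite (_ : FMonom _ = mone) //; apply: val_inj; rewrite /= fm1.
Qed.

Section Evaluation.
Variables (A : lmodType k) (mul : A -> A -> A) (one : A) (g : 'I_d -> A).
Hypotheses (mull : forall v, linear (mul^~ v)) (mulr : forall u, linear (mul u)).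
Hypotheses (mul1 : forall v, mul one v = v).
Hypothesis mulg1 : forall i, mul (g i) one = g i.
Hypothesis mulgA : forall i u v, mul (g i) (mul u v) = mul (mul (g i) u) v.

(** The nesting is to the right because [mul] is only known to associate when its left factor is a
    generator. *)
Definition word_eval w : A := foldr (fun i => mul (g i)) one w.

Definition free_eval a : A := \sum_(w <- msupp a) a@_w *: word_eval w.

Lemma free_evalEw (D : {fset {fmonom 'I_d}}) a : (msupp a `<=` D)%fset ->
  free_eval a = \sum_(w <- D) a@_w *: word_eval w.
Proof.
move=> le; rewrite [LHS](big_fset_incl _ le) => //= w wD /mcoeff_outdom ->.
by rewrite scale0r.
Qed.

Lemma free_eval_linear : linear free_eval.
Proof.
move=> c a b; pose D := (msupp a `|` msupp b `|` msupp (c *: a + b))%fset.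
have [Da Db Dab] : [/\ msupp a `<=` D, msupp b `<=` D
    & msupp (c *: a + b) `<=` D]%fset.
  split; rewrite /D; last exact: fsubsetUr.
    by rewrite -fsetUA; exact: fsubsetUl.
  by rewrite [(msupp a `|` _)%fset]fsetUC -fsetUA; exact: fsubsetUl.
rewrite (free_evalEw Da) (free_evalEw Db) (free_evalEw Dab) scaler_sumr.
rewrite -big_split /=; apply: eq_bigr => w _.
by rewrite mcoeffD mcoeffZ scalerDl scalerA.
Qed.

Lemma free_eval_monom w : free_eval << w >> = word_eval w.
Proof.
by rewrite /free_eval msuppU1 big_seq_fset1 mcoeffUU scale1r.
Qed.

Lemma free_eval1 : free_eval 1 = one.
Proof. by rewrite -monom1 free_eval_monom /word_eval fm1. Qed.

Lemma free_eval_genM i a : free_eval (free_gen k i * a) = mul (g i) (free_eval a).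
Proof.
have l := free_eval_linear.
rewrite [a in LHS]monalgE mulr_sumr (lin_sum _ _ _ l).
rewrite [in RHS]/free_eval (lin_sum _ _ _ (mulr (g i))).
apply: eq_bigr => w _; rewrite -scale_monom -free_scalerAr (linZ _ _ l).
rewrite (linZ _ _ (mulr (g i))); congr (_ *: _).
by case: w => s; rewrite -monom_cons free_eval_monom.
Qed.

Lemma presented_by_basis (rels : seq F) (I : finType) (M : I -> F) :
    {in rels, forall a, free_eval a = 0} ->
    (forall a, exists c : I -> k,
       two_sided_ideal rels (a - \sum_i c i *: M i)) ->
    (forall c : I -> k, \sum_i c i *: free_eval (M i) = 0 -> forall i, c i = 0) ->
    (forall u, exists c : I -> k, u = \sum_i c i *: free_eval (M i)) ->
  presented_by mul one g rels.
Proof.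
move=> rel0 Mspan Mfree Mgen; have l := free_eval_linear.
exists (linear_of l); split.
- split; first exact: free_eval1.
  exact: (eval_multiplicative free_alg_ind mull mul1 mulgA l free_eval1
            free_eval_genM).
- by move=> i; exact: (eval_gen free_eval1 free_eval_genM (mulg1 i)).
- move=> u; have [c ->] := Mgen u; exists (\sum_i c i *: M i).
  rewrite -[LHS]/(free_eval _) (lin_sum _ _ _ l).
  by apply: eq_bigr => i _; rewrite (linZ _ _ l).
exact: (eval_kernel free_alg_ind mull mulr mul1 mulgA l free_eval1
          free_eval_genM rel0 Mspan Mfree).
Qed.

End Evaluation.
End FreeAlgebra.

(** * Normal words modulo the relations *)

Section Congruence.
Variables (k : fieldType) (F : lalgType k).
Hypothesis scalerAr : forall c (a b : F), c *: (a * b) = a * (c *: b).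
Variable rels : seq F.
Implicit Types (a b u v : F) (c : k).

Definition cong a b := two_sided_ideal rels (a - b).

Lemma ideal_left u a : two_sided_ideal rels a -> two_sided_ideal rels (u * a).
Proof. by move=> Ia; rewrite -[_ * _]mulr1; exact: ideal_mul. Qed.

Lemma ideal_right u a : two_sided_ideal rels a -> two_sided_ideal rels (a * u).
Proof. by move=> Ia; rewrite -[a]mul1r; exact: ideal_mul. Qed.

Lemma ideal_scale c a : two_sided_ideal rels a -> two_sided_ideal rels (c *: a).
Proof. by move=> Ia; rewrite -[a]mul1r scalerAl; exact: ideal_left. Qed.

Lemma cong_refl a : cong a a.
Proof. by rewrite /cong subrr; exact: ideal_zero. Qed.

Lemma cong_trans b a u : cong a b -> cong b u -> cong a u.
Proof.
by move=> ab bc; rewrite /cong -(subrKA b); exact: ideal_add.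
Qed.

Lemma congD a b u v : cong a b -> cong u v -> cong (a + u) (b + v).
Proof. by move=> ab uv; rewrite /cong opprD addrACA; exact: ideal_add. Qed.

Lemma congZ c a b : cong a b -> cong (c *: a) (c *: b).
Proof. by move=> ab; rewrite /cong -scalerBr; exact: ideal_scale. Qed.

Lemma congMl u a b : cong a b -> cong (u * a) (u * b).
Proof. by move=> ab; rewrite /cong -mulrBr; exact: ideal_left. Qed.

Lemma congMr u a b : cong a b -> cong (a * u) (b * u).
Proof. by move=> ab; rewrite /cong -mulrBl; exact: ideal_right. Qed.

Lemma cong_expr_mod a n j : cong (a ^+ n) 1 -> cong (a ^+ j) (a ^+ (j %% n)).
Proof.
move=> an; rewrite {1}(divn_eq j n) addnC exprD mulnC exprM -[X in cong _ X]mulr1.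
apply: congMl; elim: (j %/ n)%N => [|q IH]; first exact: cong_refl.
by rewrite exprS; apply: cong_trans (congMr _ an) _; rewrite mul1r.
Qed.

Lemma cong_commX a b c i : cong (a * b) (c *: (b * a)) ->
  cong (a * b ^+ i) (c ^+ i *: (b ^+ i * a)).
Proof.
move=> ab; elim: i => [|i IH].
  by rewrite !expr0 mulr1 mul1r scale1r; exact: cong_refl.
rewrite [b ^+ i.+1]exprS mulrA; apply: cong_trans (congMr _ ab) _.
rewrite -scalerAl exprS -scalerA -!mulrA; apply: congZ.
by rewrite scalerAr; exact: congMl.
Qed.

Section Monomials.
Variables (n N m t : nat) (zeta : k) (y Y x X : F).
Hypotheses (n_gt0 : (0 < n)%N).
Hypotheses (yn : cong (y ^+ n) 1) (Yn : cong (Y ^+ n) 1).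
Hypotheses (xN : two_sided_ideal rels (x ^+ N)) (XN : two_sided_ideal rels (X ^+ N)).
Hypotheses (yx : cong (y * x) (zeta ^+ t *: (x * y))).
Hypotheses (YX : cong (Y * X) (zeta ^+ m *: (X * Y))).
Hypotheses (yY : cong (y * Y) (Y * y)) (xY : cong (x * Y) (zeta ^+ m *: (Y * x))).
Hypotheses (yX : cong (y * X) (zeta ^- t *: (X * y))).
Hypothesis (xX : cong (x * X) (X * x + (Y ^+ t - y ^+ m))).

Definition normal_word i j r s := X ^+ i * (Y ^+ j * (x ^+ r * y ^+ s)).

Definition in_span a := exists c : 'I_N * 'I_n * ('I_N * 'I_n) -> k,
  cong a (\sum_i c i *: normal_word i.1.1 i.1.2 i.2.1 i.2.2).

Lemma span_cong a b : cong a b -> in_span b -> in_span a.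
Proof. by move=> ab [c bc]; exists c; exact: cong_trans bc. Qed.

Lemma spanD a b : in_span a -> in_span b -> in_span (a + b).
Proof.
move=> [c ac] [e be]; exists (fun i => c i + e i).
under eq_bigr do rewrite scalerDl.
by rewrite big_split; exact: congD.
Qed.

Lemma spanZ z a : in_span a -> in_span (z *: a).
Proof.
move=> [c ac]; exists (fun i => z * c i).
under eq_bigr do rewrite -scalerA.
by rewrite -scaler_sumr; exact: congZ.
Qed.

Lemma span_ideal a : two_sided_ideal rels a -> in_span a.
Proof.
by move=> Ia; exists (fun=> 0); rewrite big1 /cong ?subr0 // => i _; rewrite scale0r.
Qed.

(** Exponents are unbounded so that multiplying by one more generator stays in range: powers of X
    and x beyond N fall into the ideal, those of Y and y are reduced modulo n. *)
Lemma span_monom i j r s : in_span (normal_word i j r s).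
Proof.
have [lei|lti] := leqP N i.
  apply: span_ideal; rewrite /normal_word -(subnKC lei) exprD.
  by do 2 apply: ideal_right.
have [ler|ltr] := leqP N r.
  apply: span_ideal; rewrite /normal_word -(subnKC ler) exprD.
  by do 2 apply: ideal_left; do 2 apply: ideal_right.
apply: (@span_cong _ (normal_word i (j %% n) r (s %% n))).
  apply: congMl; apply: cong_trans (congMr _ (cong_expr_mod j Yn)) _.
  by do 2 apply: congMl; exact: cong_expr_mod.
have ltj : (j %% n < n)%N by rewrite ltn_mod.
have lts : (s %% n < n)%N by rewrite ltn_mod.
exists (fun e => (e == (Ordinal lti, Ordinal ltj, (Ordinal ltr, Ordinal lts)))%:R).
rewrite (bigD1 (Ordinal lti, Ordinal ltj, (Ordinal ltr, Ordinal lts))) //=.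
rewrite eqxx scale1r big1 ?addr0; first exact: cong_refl.
by move=> e /negbTE ->; rewrite scale0r.
Qed.

Lemma span_lmul g a : (forall i j r s, in_span (g * normal_word i j r s)) ->
  in_span a -> in_span (g * a).
Proof.
move=> gM [c ac]; apply: span_cong (congMl g ac) _; rewrite mulr_sumr.
elim/big_ind: _ => [|u v|i _]; [|exact: spanD|].
  by apply: span_ideal; exact: ideal_zero.
by rewrite -scalerAr; exact: spanZ.
Qed.

Lemma span_X a : in_span a -> in_span (X * a).
Proof.
apply: span_lmul => i j r s; rewrite /normal_word mulrA -exprS; exact: span_monom.
Qed.

Lemma span_Y a : in_span a -> in_span (Y * a).
Proof.
apply: span_lmul => i j r s; rewrite /normal_word mulrA.
apply: span_cong (congMr _ (cong_commX i YX)) _.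
rewrite -scalerAl; apply: spanZ; rewrite -mulrA [Y * _]mulrA -exprS.
exact: span_monom.
Qed.

Lemma span_y a : in_span a -> in_span (y * a).
Proof.
apply: span_lmul => i j r s; rewrite /normal_word mulrA.
apply: span_cong (congMr _ (cong_commX i yX)) _.
rewrite -scalerAl; apply: spanZ; rewrite -mulrA [y * (Y ^+ j * _)]mulrA.
have yY1 : cong (y * Y) (1 *: (Y * y)) by rewrite scale1r.
apply: span_cong (congMl _ (congMr _ (cong_commX j yY1))) _.
rewrite -scalerAl -scalerAr; apply: spanZ.
rewrite -[Y ^+ j * y * _]mulrA [y * (x ^+ r * _)]mulrA.
apply: span_cong (congMl _ (congMl _ (congMr _ (cong_commX r yx)))) _.
rewrite -scalerAl -!scalerAr; apply: spanZ; rewrite -[x ^+ r * y * _]mulrA -exprS.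
exact: span_monom.
Qed.

Lemma span_exp g e a : (forall b, in_span b -> in_span (g * b)) ->
  in_span a -> in_span (g ^+ e * a).
Proof.
move=> sg sa; elim: e => [|e IH]; first by rewrite mul1r.
by rewrite exprS -mulrA; exact: sg.
Qed.

(** Moving x past X is the only exchange that is not a mere rescaling. Induction on the exponent of
    X deals with it: the leading term is X times a shorter case, and the corrections Y^t w and y^m w
    are covered by [span_Y] and [span_y]. *)
Lemma span_x a : in_span a -> in_span (x * a).
Proof.
apply: span_lmul; elim=> [|i IH] j r s.
  rewrite /normal_word mul1r mulrA; apply: span_cong (congMr _ (cong_commX j xY)) _.
  rewrite -scalerAl; apply: spanZ; rewrite -mulrA [x * (x ^+ r * _)]mulrA -exprS.
  by have := span_monom 0 j r.+1 s; rewrite /normal_word mul1r.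
have -> : normal_word i.+1 j r s = X * normal_word i j r s.
  by rewrite /normal_word exprS -mulrA.
rewrite mulrA; apply: span_cong (congMr _ xX) _; rewrite !mulrDl.
apply: spanD; first by rewrite -mulrA; apply: span_X.
apply: spanD; first by apply: span_exp span_Y _; exact: span_monom.
rewrite mulNr -scaleN1r; apply: spanZ.
by apply: span_exp span_y _; exact: span_monom.
Qed.

Lemma span1 : in_span 1.
Proof. by have := span_monom 0 0 0 0; rewrite /normal_word !mul1r. Qed.

Lemma in_span_total :
    (forall P : F -> Prop, P 1 ->
      (forall a, P a -> P (y * a)) -> (forall a, P a -> P (Y * a)) ->
      (forall a, P a -> P (x * a)) -> (forall a, P a -> P (X * a)) ->
      (forall c a b, P a -> P b -> P (c *: a + b)) -> forall a, P a) ->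
  forall a, in_span a.
Proof.
move=> ind; apply: ind => [|a|a|a|a|c a b sa sb].
- exact: span1.
- exact: span_y.
- exact: span_Y.
- exact: span_x.
- exact: span_X.
by apply: spanD => //; exact: spanZ.
Qed.

End Monomials.
End Congruence.

(** * The algebra and the antipode of H *)

Section TaftBasis.
Variables (k : fieldType) (n N t : nat) (zeta : k) (A : falgType k) (y x : A).
Hypotheses (n_gt0 : (0 < n)%N) (yn : y ^+ n = 1) (xN : x ^+ N = 0).
Hypothesis yx : y * x = zeta ^+ t *: (x * y).
Hypothesis A_ind : forall P : A -> Prop,
  P 1 -> (forall a, P a -> P (y * a)) -> (forall a, P a -> P (x * a)) ->
  (forall c a b, P a -> P b -> P (c *: a + b)) -> forall a, P a.

Lemma expr_commute i j : y ^+ j * x ^+ i = zeta ^+ (t * i * j) *: (x ^+ i * y ^+ j).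
Proof.
have yxi r : y * x ^+ r = zeta ^+ (t * r) *: (x ^+ r * y).
  elim: r => [|r IH]; first by rewrite muln0 expr0 mulr1 mul1r scale1r.
  rewrite exprS mulrA yx -scalerAl -(mulrA x y) IH -scalerAr scalerA -exprD.
  by rewrite mulnS mulrA.
elim: j => [|j IH]; first by rewrite muln0 !expr0 mulr1 mul1r scale1r.
rewrite exprS -(mulrA y) IH -scalerAr (mulrA y (x ^+ i)) yxi -scalerAl scalerA.
by rewrite -exprD mulnS addnC -(mulrA _ y) -exprS.
Qed.

Lemma monomM i j r s : x ^+ i * y ^+ j * (x ^+ r * y ^+ s)
  = zeta ^+ (t * r * j) *: (x ^+ (i + r) * y ^+ (j + s)).
Proof.
rewrite mulrA -[_ * x ^+ r]mulrA expr_commute -scalerAr -scalerAl.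
by rewrite mulrA -exprD -mulrA -exprD.
Qed.

Lemma monom_span (a : A) :
  exists c : 'I_N * 'I_n -> k, a = \sum_e c e *: (x ^+ e.1 * y ^+ e.2).
Proof.
pose V := (\sum_(e : 'I_N * 'I_n) <[x ^+ e.1 * y ^+ e.2]>)%VS.
have VP b : reflect (exists c : 'I_N * 'I_n -> k,
    b = \sum_e c e *: (x ^+ e.1 * y ^+ e.2)) (b \in V).
  apply: (iffP idP) => [/memv_sumP[v vP ->]|[c ->]].
    have /fin_all_exists[c cP] e : exists c, v e = c *: (x ^+ e.1 * y ^+ e.2).
      by have /vlineP[c ->] := vP e isT; exists c.
    by exists c; apply: eq_bigr => e _; exact: cP.
  apply: memv_suml => e _; apply: memvZ; move: (memv_line (x ^+ e.1 * y ^+ e.2)).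
  by apply/subvP; exact: (sumv_sup e).
suff: a \in V by move/VP.
have Vmon i j : x ^+ i * y ^+ j \in V.
  have [leNi|ltiN] := leqP N i.
    by rewrite -(subnKC leNi) exprD xN !mul0r mem0v.
  rewrite -(expr_mod j yn); have ltj : (j %% n < n)%N by rewrite ltn_mod.
  move: (memv_line (x ^+ i * y ^+ (j %% n))); apply/subvP.
  exact: (sumv_sup (Ordinal ltiN, Ordinal ltj)).
elim/A_ind: a => [|a|a|c a b Va Vb].
- by have := Vmon 0 0; rewrite mul1r.
- case/VP=> c ->; rewrite mulr_sumr; apply: memv_suml => e _.
  rewrite -scalerAr memvZ //.
  have := monomM 0 1 e.1 e.2; rewrite !mul1r expr1 add0n => ->.
  by rewrite memvZ.
- case/VP=> c ->; rewrite mulr_sumr; apply: memv_suml => e _.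
  by rewrite -scalerAr mulrA -exprS memvZ.
by rewrite memvD // memvZ.
Qed.

(** Spanning alone suffices here. Every later identity between functionals on H is checked on
    monomials this way. *)
Lemma eq_on_monom (W : lmodType k) (f g : A -> W) : linear f -> linear g ->
  (forall i j, (i < N)%N -> (j < n)%N ->
     f (x ^+ i * y ^+ j) = g (x ^+ i * y ^+ j)) -> f =1 g.
Proof.
move=> lf lg fg a; have [c ->] := monom_span a.
rewrite (lin_sum _ _ _ lf) (lin_sum _ _ _ lg); apply: eq_bigr => e _.
by rewrite (linZ _ _ lf) (linZ _ _ lg) fg ?ltn_ord.
Qed.

End TaftBasis.

Lemma comul_expr (k : fieldType) (H : hopfAlgType k) (u : H) j :
  comul u = u \tens u -> comul (u ^+ j) = u ^+ j \tens u ^+ j.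
Proof.
move=> Du; elim: j => [|j IH]; first by rewrite !expr0 comul1.
rewrite exprS comulM IH Du /tens_mul tliftE ?tliftE //; lin.
Qed.

Lemma counit_expr (k : fieldType) (H : hopfAlgType k) (u : H) j :
  counit u = 1 -> counit (u ^+ j) = 1.
Proof.
move=> eu; elim: j => [|j IH]; first by rewrite expr0 counit1.
by rewrite exprS counitM IH eu mulr1.
Qed.

Section Antipode.
Variables (k : fieldType) (n N : nat) (H : hopfAlgType k) (y g gi x : H).
Hypotheses (n_gt0 : (0 < n)%N) (yn : y ^+ n = 1).
Hypotheses (Dy : comul y = y \tens y) (ey : counit y = 1).
Hypotheses (gK : gi * g = 1) (Kg : g * gi = 1).
Hypotheses (Dg : comul g = g \tens g) (eg : counit g = 1).
Hypotheses (Dgi : comul gi = gi \tens gi) (egi : counit gi = 1).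
Hypotheses (Dx : comul x = g \tens x + x \tens 1) (ex : counit x = 0).
Hypothesis H_ind : forall P : H -> Prop,
  P 1 -> (forall a, P a -> P (y * a)) -> (forall a, P a -> P (x * a)) ->
  (forall c a b, P a -> P b -> P (c *: a + b)) -> forall a, P a.

Let yi := y ^+ n.-1.

Let yK : yi * y = 1.
Proof. by rewrite -exprSr prednK. Qed.

Let Ky : y * yi = 1.
Proof. by rewrite -exprS prednK. Qed.

Lemma antipode1 : antipode (1 : H) = 1.
Proof.
have := antipodel (1 : H); rewrite comul1 tliftE ?counit1 ?scale1r ?mulr1 //; lin.
Qed.

(** Induction on [a] along left multiplication by y and x, where the formulas for S(yc) and S(xc)
    are already available. *)
Lemma antipodeM (a b : H) : antipode (a * b) = antipode b * antipode a.
Proof.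
have Sy c : antipode (y * c) = antipode c * yi := antipode_glikel Ky Dy ey c.
have Sx c : antipode (x * c) = - antipode c * gi * x
  := antipode_skewl Kg Dg eg Dx ex c.
elim/H_ind: a b => [|a IH|a IH|c a a' IH IH'] b.
- by rewrite mul1r antipode1 mulr1.
- by rewrite -mulrA !Sy IH mulrA.
- by rewrite -mulrA !Sx IH !mulNr mulrN !mulrA.
by rewrite mulrDl -scalerAl !linearP /= IH IH' mulrDr scalerAr.
Qed.

Lemma antipode_glike (u ui : H) : ui * u = 1 -> u * ui = 1 ->
  comul u = u \tens u -> counit u = 1 -> antipode u = ui.
Proof.
move=> uK Ku Du eu; rewrite -[u in LHS]mulr1 (antipode_glikel Ku Du eu).
by rewrite antipode1 mul1r.
Qed.

(** Gives a preimage of x, which both surjectivity and the value of S^-1(x) rest on. *)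
Lemma antipode_skew : antipode (- (x * gi)) = x.
Proof.
rewrite linearN /= antipodeM (antipode_glike Kg gK) // -[x in LHS]mulr1.
rewrite (antipode_skewl Kg Dg eg Dx ex) antipode1.
by rewrite !mulNr mul1r mulrN opprK mulrA Kg mul1r.
Qed.

(** The image contains y and x, so by antimultiplicativity it is stable under left multiplication by
    them, and it contains 1. *)
Lemma antipode_surj : limg (antipode : 'End(H)) = fullv.
Proof.
apply/eqP; rewrite eqEsubv subvf /=; apply/subvP => a _.
have SE b : (antipode : 'End(H)) b \in limg (antipode : 'End(H)).
  by apply: memv_img; exact: memvf.
elim/H_ind: a => [|a /memv_imgP[b _ ->]|a /memv_imgP[b _ ->]|c a b Va Vb].
- by rewrite -antipode1.
- have {1}<- : antipode yi = y.
    apply: (antipode_glike Ky yK).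
      exact: comul_expr.
    exact: counit_expr.
  by rewrite -antipodeM.
- by rewrite -{1}antipode_skew -antipodeM.
by rewrite memvD // memvZ.
Qed.

Lemma antipode_invVK (a : H) : antipode (antipode_inv H a) = a.
Proof. by rewrite /antipode_inv limg_lfunVK ?antipode_surj ?memvf. Qed.

Lemma antipode_invK (a : H) : antipode_inv H (antipode a) = a.
Proof.
(* By rank-nullity a surjective endomorphism has trivial kernel. *)
apply: lker0_lfunK.
rewrite -dimv_eq0 -(eqn_add2r (\dim (limg (antipode : 'End(H))))).
by rewrite -{1}(capfv (lker _)) limg_ker_dim antipode_surj.
Qed.

Lemma antipode_invM (a b : H) :
  antipode_inv H (a * b) = antipode_inv H b * antipode_inv H a.
Proof.
by rewrite -[in LHS](antipode_invVK a) -[in LHS](antipode_invVK b) -antipodeM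
  antipode_invK.
Qed.

Lemma antipode_inv1 : antipode_inv H 1 = 1.
Proof. by rewrite -[in LHS]antipode1 antipode_invK. Qed.

Lemma antipode_inv_glike (u ui : H) : ui * u = 1 -> u * ui = 1 ->
  comul ui = ui \tens ui -> counit ui = 1 -> antipode_inv H u = ui.
Proof.
by move=> uK Ku Du eu; rewrite -(antipode_glike Ku uK Du eu) antipode_invK.
Qed.

Lemma antipode_inv_skew : antipode_inv H x = - (x * gi).
Proof. by rewrite -[in LHS]antipode_skew antipode_invK. Qed.

End Antipode.

(** * The dual algebra and the pairing *)

Section RootsOfUnity.
Variables (k : fieldType) (n : nat) (zeta : k).
Hypothesis zprim : n.-primitive_root zeta.

(** Orthogonality of the characters of Z/n: for distinct a and b the sum is geometric, with a ratio
    different from 1 whose n-th power is 1. *)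
Lemma sum_prim_root a b : (a < n)%N -> (b < n)%N ->
  \sum_(j < n) zeta ^- (j * a) * zeta ^+ (j * b) = (a == b)%:R * n%:R.
Proof.
move=> ltan ltbn; have z0 i : zeta ^+ i != 0.
  by rewrite expf_neq0 // (prim_root_eq0 zprim) -lt0n (prim_order_gt0 zprim).
pose z := zeta ^+ b / zeta ^+ a.
have -> : \sum_(j < n) zeta ^- (j * a) * zeta ^+ (j * b) = \sum_(j < n) z ^+ j.
  apply: eq_bigr => j _; rewrite expr_div_n -!exprM mulrC.
  by rewrite [(a * j)%N]mulnC [(b * j)%N]mulnC.
have [e|ab] := eqVneq a b.
  rewrite /z e divff // mul1r (eq_bigr (fun=> 1)) => [|j _]; last exact: expr1n.
  by rewrite sumr_const card_ord.
have z1 : z - 1 != 0.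
  rewrite subr_eq0; apply: contra ab => /eqP e.
  have : zeta ^+ a == zeta ^+ b by rewrite -[X in X == _]mul1r -e divfK.
  by rewrite (eq_prim_root_expr zprim) !modn_small.
apply: (mulfI z1); rewrite -subrX1 mul0r mulr0 expr_div_n -!exprM.
by rewrite ![(_ * n)%N]mulnC !exprM (prim_expr_order zprim) !expr1n divr1 subrr.
Qed.

Definition qint (q : k) i := \sum_(r < i) q ^+ r.
Definition qfact (q : k) i := \prod_(r < i) qint q r.+1.

(** A factor (r+1)_q = 0 would give q^(r+1) = 1 with r+1 below the order of q. It is applied below
    to q = zeta^(mt), of order N. *)
Lemma qfact_neq0 i : (i < n)%N -> qfact zeta i != 0.
Proof.
move=> ltin; apply/prodf_neq0 => r _; apply/negP => /eqP q0.
have := subrX1 zeta r.+1; rewrite -/(qint zeta r.+1) q0 mulr0 => /eqP.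
rewrite subr_eq0 -(prim_order_dvd zprim) => /(dvdn_leq (ltn0Sn r)).
by rewrite leqNgt (leq_ltn_trans (ltn_ord r) ltin).
Qed.

End RootsOfUnity.

Section DualAlgebra.
Variables (k : fieldType) (H : hopfAlgType k).
Implicit Types p q : 'Hom(H, k^o).

Definition dual_exp p i := iter i (dual_mul p) (dual_one H).

Lemma dual_mulp1 p : dual_mul p (dual_one H) = p.
Proof.
apply/lfunP => a; rewrite dual_mulE -[in RHS](counitr a) (tlift_lin (F := p)).
  by apply: eq_tlift => b c; rewrite linearZ mulrC.
by lin.
Qed.

(** The counit axiom at x reads x + counit(x) 1 = x; applying the counit to counit(x) 1 = 0
    finishes. *)
Lemma counit_skew (g x : H) : counit g = 1 ->
  comul x = g \tens x + x \tens 1 -> counit x = 0.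
Proof.
move=> eg Dx; have := counitl x; rewrite Dx tliftDl !tliftE; try by lin.
rewrite eg scale1r => /(congr1 (fun v => v - x)); rewrite addrAC subrr add0r => ex0.
by have := congr1 counit ex0; rewrite linearZ linear0 /= counit1 [_ *: _]mulr1.
Qed.

End DualAlgebra.

Section HnDual.
Variables (k : fieldType) (n N m t : nat) (zeta : k) (H : hopfAlgType k).
Variables (y x : H) (Y X : 'Hom(H, k^o)).
Hypotheses (n_gt0 : (0 < n)%N) (N_gt1 : (1 < N)%N) (zn : zeta ^+ n = 1).
Hypotheses (yn : y ^+ n = 1) (xN : x ^+ N = 0).
Hypothesis yx : y * x = zeta ^+ t *: (x * y).
Hypothesis H_ind : forall P : H -> Prop,
  P 1 -> (forall a, P a -> P (y * a)) -> (forall a, P a -> P (x * a)) ->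
  (forall c a b, P a -> P b -> P (c *: a + b)) -> forall a, P a.
Hypotheses (Dy : comul y = y \tens y) (ey : counit y = 1).
Hypotheses (Dx : comul x = y ^+ m \tens x + x \tens 1).
Hypothesis Y_basis : forall i j, (i < N)%N -> (j < n)%N ->
  Y (x ^+ i * y ^+ j) = (i == 0%N)%:R * zeta ^+ j.
Hypothesis X_basis : forall i j, (i < N)%N -> (j < n)%N ->
  X (x ^+ i * y ^+ j) = (i == 1%N)%:R.
Implicit Types (a b : H) (p : 'Hom(H, k^o)).

Let g := y ^+ m.
Let z0 : zeta != 0.
Proof.
apply/eqP => z0; move/eqP: zn.
by rewrite z0 expr0n gtn_eqF // eq_sym oner_eq0.
Qed.
Let Dg : comul g = g \tens g := comul_expr m Dy.
Let eg : counit g = 1 := counit_expr m ey.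
Let ex : counit x = 0 := counit_skew eg Dx.
Let H_ext := eq_on_monom n_gt0 yn xN yx H_ind.

Lemma Y_monom i j : Y (x ^+ i * y ^+ j) = (i == 0%N)%:R * zeta ^+ j.
Proof.
rewrite -(expr_mod j yn) -(expr_mod j zn).
have [leNi|ltiN] := leqP N i; last by rewrite Y_basis // ltn_mod.
rewrite -{1}(subnKC leNi) exprD xN !mul0r linear0 gtn_eqF ?mul0r //.
by apply: leq_trans leNi; exact: ltnW.
Qed.

(** For [i >= N] the left side is X(0), and the right side vanishes because N > 1 excludes i = 1.
    That bound is what n not dividing mt provides. *)
Lemma X_monom i j : X (x ^+ i * y ^+ j) = (i == 1%N)%:R.
Proof.
rewrite -(expr_mod j yn).
have [leNi|ltiN] := leqP N i; last by rewrite X_basis // ltn_mod.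
rewrite -{1}(subnKC leNi) exprD xN !mul0r linear0 gtn_eqF //.
exact: leq_trans leNi.
Qed.

Lemma counit_monom i j : counit (x ^+ i * y ^+ j) = (i == 0%N)%:R :> k.
Proof.
rewrite counitM (counit_expr _ ey) mulr1; case: i => [|i].
  by rewrite expr0 counit1.
by rewrite exprS counitM ex mul0r.
Qed.

Lemma Y_mult a b : Y (a * b) = Y a * Y b.
Proof.
move: a; apply: H_ext => [||i j _ _]; try by lin.
move: b; apply: H_ext => [||r s _ _]; try by lin.
rewrite (monomM yx) linearZ /= !Y_monom addn_eq0 exprD.
have [_|ni] := eqVneq i 0%N; last by rewrite !mul0r scaler0.
have [->|nr] := eqVneq r 0%N; last by rewrite !mul0r scaler0 mulr0.
by rewrite !muln0 expr0 scale1r !mul1r.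
Qed.

(** Y is multiplicative and kills x, so in the coproduct of x^i y^j only the term with first leg g^i
    y^j contributes. The induction absorbs one x into [p] as [twist x 1 p], hence the general
    [p]. *)
Lemma dual_mul_Y p i j :
  dual_mul Y p (x ^+ i * y ^+ j) = zeta ^+ (m * i + j) * p (x ^+ i * y ^+ j).
Proof.
elim: i p => [|i IH] p.
  rewrite mul1r dual_mulE (comul_expr _ Dy) tliftE; try by lin.
  by have := Y_monom 0 j; rewrite !mul1r => ->; rewrite muln0.
rewrite exprS -mulrA dual_mulE (sw_skewl Dx); try by lin.
transitivity (zeta ^+ m * dual_mul Y (twist x 1 p) (x ^+ i * y ^+ j)).
  rewrite dual_mulE.
  rewrite (tlift_lin (F := fun c : k^o => zeta ^+ m * c : k^o)); last by lin.
  apply: eq_tlift => a b; rewrite !Y_mult twistE mulr1.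
  have := Y_monom 1 0; rewrite mul0r expr0 mulr1 expr1 => ->.
  have := Y_monom 0 m; rewrite !mul1r => ->.
  by rewrite mul0r mul0r addr0 mulrA.
by rewrite IH twistE mulr1 mulrA -exprD mulnS addnA.
Qed.

Lemma Yexp_monom e i j :
  dual_exp Y e (x ^+ i * y ^+ j) = (i == 0%N)%:R * zeta ^+ (e * j).
Proof.
elim: e => [|e IH]; first by rewrite counit_monom mul0n mulr1.
rewrite /dual_exp iterS dual_mul_Y -/(dual_exp Y e) IH mulrCA -exprD.
have [->|ni] := eqVneq i 0%N; last by rewrite !mul0r.
by rewrite muln0 add0n mulSn.
Qed.

Lemma Yexp_mult e a b : dual_exp Y e (a * b) = dual_exp Y e a * dual_exp Y e b.
Proof.
move: a; apply: H_ext => [||i j _ _]; try by lin.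
move: b; apply: H_ext => [||r s _ _]; try by lin.
rewrite (monomM yx) linearZ /= !Yexp_monom addn_eq0 mulnDr exprD.
have [_|ni] := eqVneq i 0%N; last by rewrite !mul0r scaler0.
have [->|nr] := eqVneq r 0%N; last by rewrite !mul0r scaler0 mulr0.
by rewrite !muln0 expr0 scale1r !mul1r.
Qed.

Lemma Yexp_order : dual_exp Y n = dual_one H.
Proof.
apply/lfunP; apply: H_ext => [||i j _ _]; try by lin.
by rewrite Yexp_monom counit_monom exprM zn expr1n mulr1.
Qed.

(** The factor Y^t records the scalar in y^j x = zeta^(tj) x y^j, the only other way for a product
    of monomials to have degree 1 in x. *)
Lemma X_skew a b : X (a * b) = X a * counit b + dual_exp Y t a * X b.
Proof.
move: a; apply: H_ext => [||i j _ _]; try by lin.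
move: b; apply: H_ext => [||r s _ _]; try by lin.
rewrite (monomM yx) linearZ /= !X_monom counit_monom Yexp_monom.
case: i => [|i].
  rewrite mul0r add0r mul1r add0n; case: (r =P 1%N) => [->|_]; last first.
    by rewrite scaler0 mulr0.
  by rewrite muln1.
rewrite mul0r mul0r addr0 addSn eqSS addn_eq0 eqSS.
case: (r =P 0%N) => [->|_]; last by rewrite andbF scaler0 mulr0.
by rewrite andbT muln0 mul0n scale1r mulr1.
Qed.

Let q := zeta ^+ (m * t).

(** Left multiplication by X is the transpose of the q-derivation in x. By [X_skew], X(g a) = q X(a)
    and X(x a) = counit(a), which yields the recursion (i+1)_q = 1 + q (i)_q. At i = 0 the truncated
    [i.-1] is harmless since (0)_q = 0. *)
Lemma dual_mul_X p i j :
  dual_mul X p (x ^+ i * y ^+ j) = qint q i * p (x ^+ i.-1 * y ^+ j).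
Proof.
elim: i p => [|i IH] p.
  rewrite mul1r dual_mulE (comul_expr _ Dy) tliftE; try by lin.
  have := X_monom 0 j; rewrite !mul1r => ->.
  by rewrite /qint big_ord0 !mul0r.
rewrite exprS -mulrA dual_mulE (sw_skewl Dx); try by lin.
transitivity (q * dual_mul X (twist x 1 p) (x ^+ i * y ^+ j) + p (x ^+ i * y ^+ j)).
  rewrite dual_mulE (tlift_lin (F := fun c : k^o => q * c : k^o)); last by lin.
  rewrite -[in X in _ = _ + X](counitl (x ^+ i * y ^+ j)).
  rewrite (tlift_lin (F := p)); last by lin.
  rewrite -tliftD; apply: eq_tlift => a b; rewrite !X_skew twistE mulr1 linearZ.
  have := X_monom 1 0; rewrite expr0 mulr1 expr1 => ->.
  have := X_monom 0 m; rewrite !mul1r => ->.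
  have := Yexp_monom t 1 0; rewrite mul0r expr0 mulr1 expr1 => ->.
  have := Yexp_monom t 0 m; rewrite !mul1r => ->.
  by rewrite /= !mul0r add0r addr0 mulrA /q mulnC.
rewrite IH twistE mulr1 /= /qint big_ord_recl expr0 mulrDl mul1r addrC.
congr (_ + _).
case: i {IH} => [|i]; first by rewrite !big_ord0 !mul0r mulr0.
rewrite /= mulrA mulrA -exprS mulr_sumr; congr (_ * _).
by apply: eq_bigr => r _; rewrite exprS.
Qed.

Definition dual_monom i j := iter i (dual_mul X) (dual_exp Y j).

(** Each X lowers the exponent of x by one at the cost of a q-integer. If r < i the factor (0)_q
    occurs; if r > i, Y^j is finally evaluated at a monomial still containing x. *)
Lemma pairing i j r s : dual_monom i j (x ^+ r * y ^+ s)
  = (i == r)%:R * (qfact q i * zeta ^+ (j * s)).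
Proof.
rewrite /qfact; elim: i r => [|i IH] r.
  by rewrite Yexp_monom big_ord0 mul1r eq_sym.
rewrite /dual_monom iterS dual_mul_X -/(dual_monom i j) IH.
case: r => [|r] /=; first by rewrite /qint big_ord0 !mul0r.
rewrite eqSS big_ord_recr /=; case: eqP => [->|_]; last by rewrite !mul0r mulr0.
by rewrite !mul1r mulrA [_ * qint _ _]mulrC.
Qed.

Lemma Xexp_order : dual_exp X N = 0.
Proof.
apply/lfunP; apply: H_ext => [||i j ltiN _]; try by lin.
by have := pairing N 0 i j; rewrite gtn_eqF // mul0r lfunE.
Qed.

Lemma YX_comm : dual_mul Y X = zeta ^+ m *: dual_mul X Y.
Proof.
apply/lfunP; apply: H_ext => [||i j _ _]; try by lin.
rewrite dual_mul_Y X_monom lfunE /= dual_mul_X Y_monom.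
case: i => [|[|i]] /=; rewrite ?mulr0 ?mul0r ?mulr0 ?scaler0 //.
  by rewrite /qint big_ord0 mul0r scaler0.
rewrite mulr1 muln1 exprD mul1r /qint big_ord_recl big_ord0 expr0 addr0 mul1r //.
Qed.

Lemma dual_comul_counit : dual_comul (dual_one H) = dual_one H \tens dual_one H.
Proof.
apply: dual_tensor_inj => a b; rewrite dual_comulE tliftE ?counitM //; lin.
Qed.

Lemma dual_comul_Y : dual_comul Y = Y \tens Y.
Proof.
apply: dual_tensor_inj => a b; rewrite dual_comulE tliftE ?Y_mult //; lin.
Qed.

Lemma dual_comul_X : dual_comul X = X \tens dual_one H + dual_exp Y t \tens X.
Proof.
apply: dual_tensor_inj => a b.
rewrite dual_comulE tliftDl !tliftE ?X_skew //; lin.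
Qed.

(** * Dual bases of H, of its dual and of the double *)

Section DualBases.
Hypotheses (zprim : n.-primitive_root zeta) (qprim : N.-primitive_root q).
Hypothesis n_neq0 : n%:R != 0 :> k.

Let norm i := (qfact q i * n%:R)^-1.

(** The coordinate of [p] at X^i Y^j. For fixed i the pairing matrix is (i)_q! times the character
    table of Z/n, which is inverted by the conjugate characters divided by n; [hcoef] does the same
    with the two sides exchanged. *)
Definition pcoef i j (p : 'Hom(H, k^o)) : k^o :=
  \sum_(b < n) norm i * zeta ^- (j * b) * p (x ^+ i * y ^+ b).

Definition hcoef i j (h : H) : k^o :=
  \sum_(b < n) norm i * zeta ^- (j * b) * dual_monom i b h.

Lemma lin_pcoef i j : linear (pcoef i j).
Proof. by rewrite /pcoef; lin. Qed.

Lemma lin_hcoef i j : linear (hcoef i j).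
Proof. by rewrite /hcoef; lin. Qed.

Let normK i : (i < N)%N -> norm i * qfact q i * n%:R = 1.
Proof.
by move=> ltiN; rewrite -mulrA mulVf // mulf_neq0 // (qfact_neq0 qprim).
Qed.

Lemma pcoef_monom i j r s : (i < N)%N -> (j < n)%N -> (s < n)%N ->
  pcoef i j (dual_monom r s) = ((r == i) && (s == j))%:R.
Proof.
move=> ltiN ltjn ltsn; rewrite /pcoef.
have [->|ri] := eqVneq r i; last first.
  by rewrite big1 // => b _; rewrite pairing (negbTE ri) mul0r mulr0.
transitivity (norm i * qfact q i
   * \sum_(b < n) zeta ^- (b * j) * zeta ^+ (b * s)).
  rewrite mulr_sumr; apply: eq_bigr => b _; rewrite pairing eqxx mul1r.
  by rewrite -!mulrA; congr (_ * _); rewrite mulrCA mulnC [(s * b)%N]mulnC.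
rewrite sum_prim_root // eq_sym; case: eqP => _ /=; last by rewrite mul0r mulr0.
by rewrite mul1r normK.
Qed.

Lemma hcoef_monom i j r s : (i < N)%N -> (j < n)%N -> (s < n)%N ->
  hcoef i j (x ^+ r * y ^+ s) = ((r == i) && (s == j))%:R.
Proof.
move=> ltiN ltjn ltsn; rewrite /hcoef.
have [->|ri] := eqVneq r i; last first.
  by rewrite big1 // => b _; rewrite pairing eq_sym (negbTE ri) mul0r mulr0.
transitivity (norm i * qfact q i
   * \sum_(b < n) zeta ^- (b * j) * zeta ^+ (b * s)).
  rewrite mulr_sumr; apply: eq_bigr => b _; rewrite pairing eqxx mul1r.
  by rewrite -!mulrA; congr (_ * _); rewrite mulrCA mulnC.
rewrite sum_prim_root // eq_sym; case: eqP => _ /=; last by rewrite mul0r mulr0.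
by rewrite mul1r normK.
Qed.

Lemma dual_monom_span p :
  p = \sum_(e : 'I_N * 'I_n) (pcoef e.1 e.2 p : k) *: dual_monom e.1 e.2.
Proof.
apply/lfunP; apply: H_ext => [||i j ltiN ltjn]; try by lin.
rewrite sum_lfunE -(pair_bigA _ (fun (i' : 'I_N) (j' : 'I_n) =>
  ((pcoef i' j' p : k) *: dual_monom i' j')%VF (x ^+ i * y ^+ j))) /=.
rewrite (bigD1 (Ordinal ltiN)) //= [X in _ + X]big1 ?addr0; last first.
  move=> i' /negbTE ni; rewrite big1 // => j' _.
  rewrite lfunE /= pairing -[(i' : nat) == i]/(i' == Ordinal ltiN) ni.
  by rewrite mul0r scaler0.
(* Fourier inversion: the inner sum over [j'] is n when b = j and 0 otherwise, so the sum over b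
   picks out the value of [p] at x^i y^j. *)
transitivity (norm i * qfact q i * \sum_(b < n)
   (\sum_(j' < n) zeta ^- (j' * b) * zeta ^+ (j' * j)) * p (x ^+ i * y ^+ b)).
  rewrite (bigD1 (Ordinal ltjn)) //= [X in _ + X]big1 ?addr0.
    by rewrite sum_prim_root // eqxx mul1r mulrA normK ?mul1r.
  move=> b /negbTE nb; rewrite sum_prim_root //.
  by rewrite -[(b : nat) == j]/(b == Ordinal ltjn) nb !mul0r.
rewrite mulr_sumr; under [LHS]eq_bigr => b _ do rewrite mulr_suml mulr_sumr.
rewrite [LHS]exchange_big; apply: eq_bigr => j' _.
rewrite lfunE /= pairing eqxx mul1r.
rewrite /pcoef scaler_suml; apply: eq_bigr => b _.
rewrite /GRing.scale /= -!mulrA; congr (_ * _).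
by rewrite mulrCA; congr (_ * _); rewrite [RHS]mulrCA; congr (_ * _); rewrite mulrC.
Qed.

Lemma monom_span_coef h :
  h = \sum_(e : 'I_N * 'I_n) (hcoef e.1 e.2 h : k) *: (x ^+ e.1 * y ^+ e.2).
Proof.
move: h; apply: H_ext => [||i j ltiN ltjn]; first exact: lin_id.
  move=> c a b; rewrite scaler_sumr -big_split; apply: eq_bigr => e _.
  by rewrite lin_hcoef scalerDl scalerA.
rewrite (bigD1 (Ordinal ltiN, Ordinal ltjn)) //= hcoef_monom // !eqxx scale1r.
rewrite big1 ?addr0 // => -[i' j'] ne /=; rewrite hcoef_monom //.
case: eqP => [ei|_]; last by rewrite scale0r.
case: eqP => [ej|_]; last by rewrite scale0r.
by case/eqP: ne; congr (_, _); apply: val_inj.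
Qed.

(** The functional [f], a tensor product of coordinate functionals, reads off the coefficient at
    [e]. *)
Lemma double_monom_free (c : 'I_N * 'I_n * ('I_N * 'I_n) -> k) :
  \sum_e c e *: (dual_monom e.1.1 e.1.2 \tens (x ^+ e.2.1 * y ^+ e.2.2)) = 0 ->
  forall e, c e = 0.
Proof.
move=> c0 e.
pose f w : k^o := \sw_(p, h <- w) (pcoef e.1.1 e.1.2 p * hcoef e.2.1 e.2.2 h).
have lp := lin_pcoef e.1.1 e.1.2; have lh := lin_hcoef e.2.1 e.2.2.
have lf : linear f by rewrite /f; lin.
have := lin0 lf; rewrite -c0 (lin_sum _ _ _ lf).
rewrite (bigD1 e) //= big1 ?addr0 => [|e' ne].
  rewrite (linZ _ _ lf) /f tliftE; try by lin.
  by rewrite pcoef_monom // hcoef_monom // !eqxx mulr1 => <-; rewrite [RHS]mulr1.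
rewrite (linZ _ _ lf) /f tliftE; try by lin.
rewrite pcoef_monom // hcoef_monom // -natrM mulnb.
suff -> : ((e'.1.1 == e.1.1 :> nat) && (e'.1.2 == e.1.2 :> nat)
   && ((e'.2.1 == e.2.1 :> nat) && (e'.2.2 == e.2.2 :> nat))) = false.
  by rewrite scaler0.
apply: contraNF ne; clear; case: e e' => [[i j] [r s]] [[i' j'] [r' s']] /=.
case/andP=> /andP[/eqP/val_inj-> /eqP/val_inj->].
by case/andP=> /eqP/val_inj-> /eqP/val_inj->.
Qed.

Lemma double_monom_span (w : drinfeld_double H) :
  exists c : 'I_N * 'I_n * ('I_N * 'I_n) -> k,
  w = \sum_e c e *: (dual_monom e.1.1 e.1.2 \tens (x ^+ e.2.1 * y ^+ e.2.2)).
Proof.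
pose c (e : 'I_N * 'I_n * ('I_N * 'I_n)) w : k^o :=
   \sw_(p, h <- w) (pcoef e.1.1 e.1.2 p * hcoef e.2.1 e.2.2 h).
have lc e : linear (c e) by apply: tlift_is_linear.
exists (fun e => c e w).
pose G w : drinfeld_double H := \sum_e (c e w : k) *:
  (dual_monom e.1.1 e.1.2 \tens (x ^+ e.2.1 * y ^+ e.2.2)).
have lG : linear G by rewrite /G; lin.
rewrite -[RHS]/(G w) -[LHS]/(idfun w); apply: tensor_ext => // p h /=.
rewrite [in LHS](dual_monom_span p) [in LHS](monom_span_coef h).
rewrite (lin_sum _ _ _ (lin_tensl _ (@lin_id _ _))).
rewrite /G -(pair_bigA _ (fun e1 e2 : 'I_N * 'I_n => (c (e1, e2) (p \tens h) : k) *: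
     (dual_monom e1.1 e1.2 \tens (x ^+ e2.1 * y ^+ e2.2)))) /=.
apply: eq_bigr => e1 _; rewrite (lin_sum _ _ _ (lin_tensr _ (@lin_id _ _))).
apply: eq_bigr => e2 _.
have lp := lin_pcoef e1.1 e1.2; have lh := lin_hcoef e2.1 e2.2.
rewrite /c tliftE; try by lin.
by rewrite tensZl tensZr scalerA.
Qed.

End DualBases.

(** * Relations and coproducts of the four generators of the double *)

Section Relations.
Let yi := y ^+ n.-1.
(** The inverse of g, written as a power of y so that [comul_expr] and [counit_expr] show it
    grouplike. *)
Let gi := y ^+ (m * n.-1).
Local Notation "u ** v" := (double_mul u v) (at level 40, left associativity).
Local Notation yD := (double_inr y).
Local Notation YD := (double_inl Y).
Local Notation xD := (double_inr x).
Local Notation XD := (double_inl X).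

Let yK : yi * y = 1. Proof. by rewrite -exprSr prednK. Qed.
Let Ky : y * yi = 1. Proof. by rewrite -exprS prednK. Qed.

Let gK : gi * g = 1.
Proof. by rewrite -exprD -mulnSr prednK // mulnC exprM yn expr1n. Qed.

Let Kg : g * gi = 1.
Proof. by rewrite -exprD addnC -mulnSr prednK // mulnC exprM yn expr1n. Qed.

Let Dyi : comul yi = yi \tens yi := comul_expr _ Dy.
Let Dgi : comul gi = gi \tens gi := comul_expr _ Dy.
Let eyi : counit yi = 1 := counit_expr _ ey.
Let egi : counit gi = 1 := counit_expr _ ey.

Let SM : forall a b, antipode_inv H (a * b) = antipode_inv H b * antipode_inv H a
  := antipode_invM n_gt0 yn Dy ey gK Kg Dg eg Dgi egi Dx ex H_ind.
Let S1 : antipode_inv H 1 = 1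
  := antipode_inv1 n_gt0 yn Dy ey gK Kg Dg eg Dgi egi Dx ex H_ind.
Let Sx : antipode_inv H x = - (x * gi)
  := antipode_inv_skew n_gt0 yn Dy ey gK Kg Dg eg Dgi egi Dx ex H_ind.
Let Sy : antipode_inv H y = yi
  := antipode_inv_glike n_gt0 yn Dy ey gK Kg Dg eg Dgi egi Dx ex H_ind yK Ky Dyi eyi.
Let Sg : antipode_inv H g = gi
  := antipode_inv_glike n_gt0 yn Dy ey gK Kg Dg eg Dgi egi Dx ex H_ind gK Kg Dgi egi.

Let mul_y p h : yD ** (p \tens h) = twist yi y p \tens (y * h).
Proof. exact: double_mul_glike. Qed.

Let mul_x p h : xD ** (p \tens h)
  = - (twist (x * gi) g p \tens (g * h)) + twist 1 g p \tens (x * h)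
    + twist 1 x p \tens h.
Proof. exact: double_mul_skew. Qed.

Lemma double_mul_inl_tens p p' h :
  double_inl p ** (p' \tens h) = dual_mul p p' \tens h.
Proof. exact: double_mul_inl. Qed.

Lemma double_mul_1 (w : drinfeld_double H) : double_one H ** w = w.
Proof. exact: double_mul1. Qed.

Lemma double_mul_gen_assoc i (u v : drinfeld_double H) :
  let c := tnth [tuple yD; YD; xD; XD] i in c ** (u ** v) = c ** u ** v.
Proof.
have SyM b : antipode_inv H (y * b) = antipode_inv H b * yi by rewrite SM Sy.
have SgM b : antipode_inv H (g * b) = antipode_inv H b * gi by rewrite SM Sg.
case: i => [[|[|[|[|//]]]] lti]; rewrite /tnth /=.
- exact: (double_mulA_glike Dy Dyi _ _ Sy SyM).
- exact: double_mulA_inl.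
- by apply: (double_mulA_skew (g := g) (gi := gi)).
- exact: double_mulA_inl.
Qed.

Lemma inr_y_mul h : yD ** double_inr h = double_inr (y * h).
Proof.
rewrite mul_y (_ : twist yi y (dual_one H) = dual_one H) //.
by rewrite counit_twist eyi ey mulr1 scale1r.
Qed.

Lemma inr_x_mul h : xD ** double_inr h = double_inr (x * h).
Proof.
rewrite mul_x !counit_twist counitM ex eg counit1 !mul0r mulr1 mulr0.
by rewrite !scale0r scale1r !tens0l oppr0 add0r addr0.
Qed.

Lemma inr_x_exp i h :
  iter i (double_mul xD) (double_inr h) = double_inr (x ^+ i * h).
Proof.
by elim: i => [|i IH]; rewrite ?mul1r // iterS IH inr_x_mul exprS mulrA.
Qed.

Lemma inr_y_exp i h :
  iter i (double_mul yD) (double_inr h) = double_inr (y ^+ i * h).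
Proof.
by elim: i => [|i IH]; rewrite ?mul1r // iterS IH inr_y_mul exprS mulrA.
Qed.

Lemma inl_exp p i p' h : iter i (double_mul (double_inl p)) (p' \tens h)
  = iter i (dual_mul p) p' \tens h.
Proof. by elim: i => [|i IH] //; rewrite !iterS IH double_mul_inl_tens. Qed.

Lemma inl_mul p p' : double_inl p ** double_inl p' = double_inl (dual_mul p p').
Proof. exact: double_mul_inl_tens. Qed.

Let Yx : Y x = 0.
Proof. by have := Y_monom 1 0; rewrite expr0 mulr1 expr1 mul0r. Qed.
Let Yg : Y g = zeta ^+ m.
Proof. by have := Y_monom 0 m; rewrite expr0 !mul1r. Qed.
Let Yy : Y y = zeta.
Proof. by have := Y_monom 0 1; rewrite expr0 !mul1r. Qed.
Let Yyi : Y yi * zeta = 1.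
Proof. by rewrite -Yy -Y_mult yK; have := Y_monom 0 0; rewrite expr0 !mul1r. Qed.

Lemma double_rel_yY : yD ** YD = YD ** yD.
Proof.
rewrite mul_y double_mul_inl_tens dual_mulp1 mulr1; congr (_ \tens _).
by apply/lfunP => a; rewrite twistE !Y_mult Yy mulrAC Yyi mul1r.
Qed.

(** Of the three terms of [mul_x] only the middle one survives, because Y kills x; it carries the
    scalar Y(g). *)
Lemma double_rel_xY : xD ** YD = zeta ^+ m *: (YD ** xD).
Proof.
rewrite mul_x double_mul_inl_tens dual_mulp1 !mulr1 -tensZl.
have -> : twist (x * gi) g Y = 0.
  by apply/lfunP => a; rewrite twistE !Y_mult Yx !mul0r lfunE.
have -> : twist 1 x Y = 0.
  by apply/lfunP => a; rewrite twistE mul1r Y_mult Yx mulr0 lfunE.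
rewrite !tens0l oppr0 add0r addr0; congr (_ \tens _).
by apply/lfunP => a; rewrite twistE mul1r Y_mult Yg lfunE /= mulrC.
Qed.

Let Xx : X x = 1.
Proof. by have := X_monom 1 0; rewrite expr0 mulr1 expr1. Qed.
Let Xy j : X (y ^+ j) = 0.
Proof. by have := X_monom 0 j; rewrite expr0 !mul1r. Qed.
Let Ytx : dual_exp Y t x = 0.
Proof. by have := Yexp_monom t 1 0; rewrite expr0 mulr1 expr1 mul0r. Qed.
Let Yty j : dual_exp Y t (y ^+ j) = zeta ^+ (t * j).
Proof. by have := Yexp_monom t 0 j; rewrite expr0 !mul1r. Qed.

(** Conjugation by y multiplies X by Y^t(y^-1), since X vanishes on powers of y. *)
Lemma double_rel_yX : yD ** XD = zeta ^- t *: (XD ** yD).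
Proof.
rewrite mul_y double_mul_inl_tens dual_mulp1 mulr1 -tensZl; congr (_ \tens _).
apply/lfunP => a; rewrite twistE !X_skew ey Xy mulr1 lfunE /=.
have := Xy 1; rewrite expr1 => ->.
have e : dual_exp Y t yi = zeta ^- t.
  apply: (mulIf (expf_neq0 t z0)).
  rewrite mulVf ?expf_neq0 // Yty -exprD -mulnSr prednK //.
  by rewrite mulnC exprM zn expr1n.
by rewrite mulr0 addr0 mul0r add0r e.
Qed.

(** The three terms of the iterated coproduct of x contribute one summand each: twisting X gives the
    counit, X and Y^t, tensored with -g, x and 1 respectively. *)
Lemma double_rel_xX :
  xD ** XD = XD ** xD + (double_inl (dual_exp Y t) - double_inr g).
Proof.
rewrite mul_x double_mul_inl_tens dual_mulp1 !mulr1.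
have -> : twist (x * gi) g X = dual_one H.
  apply/lfunP => a; rewrite twistE -!mulrA [LHS]X_skew Xx Ytx mul1r mul0r addr0.
  by rewrite !counitM egi eg mul1r mulr1.
have -> : twist 1 g X = X.
  by apply/lfunP => a; rewrite twistE mul1r X_skew eg Xy mulr1 mulr0 addr0.
have -> : twist 1 x X = dual_exp Y t.
  by apply/lfunP => a; rewrite twistE mul1r X_skew ex Xx mulr1 mulr0 add0r.
by rewrite addrA [RHS]addrC addrA.
Qed.

Lemma double_rel_YX : YD ** XD = zeta ^+ m *: (XD ** YD).
Proof. by rewrite !inl_mul YX_comm /double_inl tensZl. Qed.

Lemma double_rel_yx : yD ** xD = zeta ^+ t *: (xD ** yD).
Proof. by rewrite inr_y_mul inr_x_mul yx /double_inr tensZr. Qed.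

Lemma double_exp_y i : double_exp yD i = double_inr (y ^+ i).
Proof. by rewrite -[y ^+ i]mulr1 -inr_y_exp. Qed.

Lemma double_exp_x i : double_exp xD i = double_inr (x ^+ i).
Proof. by rewrite -[x ^+ i]mulr1 -inr_x_exp. Qed.

Lemma double_exp_inl p i : double_exp (double_inl p) i = double_inl (dual_exp p i).
Proof. exact: inl_exp. Qed.

Lemma double_monomE i j r s :
  iter i (double_mul XD) (iter j (double_mul YD)
    (iter r (double_mul xD) (double_exp yD s)))
  = dual_monom i j \tens (x ^+ r * y ^+ s).
Proof. by rewrite double_exp_y inr_x_exp !inl_exp. Qed.

Lemma grouplike_inr (u : H) : comul u = u \tens u -> counit u = 1 ->
  grouplike (@double_comul k H) (@double_counit k H) (double_inr u).
Proof.
move=> Du eu; split.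
  rewrite /double_comul tliftE; try by lin.
  rewrite dual_comul_counit tliftE; try by lin.
  by rewrite Du tliftE; try by lin.
rewrite /double_counit tliftE; rewrite /dual_counit; try by lin.
by rewrite eu counit1 mulr1.
Qed.

Lemma grouplike_inl p : dual_comul p = p \tens p -> p 1 = 1 ->
  grouplike (@double_comul k H) (@double_counit k H) (double_inl p).
Proof.
move=> Dp p1; split.
  rewrite /double_comul tliftE; try by lin.
  rewrite Dp tliftE; try by lin.
  by rewrite comul1 tliftE; try by lin.
rewrite /double_counit tliftE; rewrite /dual_counit; try by lin.
by rewrite p1 counit1 mulr1.
Qed.

Lemma skew_primitive_x : skew_primitive (@double_comul k H) (@double_counit k H)
  (double_exp yD m) (double_one H) xD.
Proof.
split; [by rewrite double_exp_y; exact: grouplike_inr | |].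
  by apply: (grouplike_inr (u := 1)); [exact: comul1 | exact: counit1].
rewrite double_exp_y /double_comul tliftE; try by lin.
rewrite dual_comul_counit tliftE; try by lin.
by rewrite Dx tliftDl !tliftE; try by lin.
Qed.

(** In the dual of H the coproduct of X is X (x) 1 + Y^t (x) X; the co-opposite coproduct taken in
    the double exchanges the legs, which makes X a (1, Y^t)-skew primitive. *)
Lemma skew_primitive_X : skew_primitive (@double_comul k H) (@double_counit k H)
  (double_one H) (double_exp YD t) XD.
Proof.
split.
- by apply: (grouplike_inr (u := 1)); [exact: comul1 | exact: counit1].
- rewrite double_exp_inl; apply: grouplike_inl.
    apply: dual_tensor_inj => a b; rewrite dual_comulE tliftE ?Yexp_mult //; lin.
  by have := Yty 0; rewrite muln0 !expr0.
rewrite double_exp_inl /double_comul tliftE; try by lin.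
rewrite dual_comul_X tliftDl !tliftE; try by lin.
by rewrite comul1 !tliftE; try by lin.
Qed.

End Relations.
End HnDual.

(** * The presentation *)

Section ImageOfRelations.
Variables (k : fieldType) (F : lalgType k) (A : lmodType k).
Variables (mul : A -> A -> A) (one : A) (phi : F -> A).
Hypotheses (lphi : linear phi) (phi1 : phi 1 = one).
Hypothesis phiM : forall a b, phi (a * b) = mul (phi a) (phi b).

Lemma hom_exprM a i b : phi (a ^+ i * b) = iter i (mul (phi a)) (phi b).
Proof. by elim: i => [|i IH]; rewrite ?mul1r // exprS -mulrA phiM IH. Qed.

Lemma hom_expr a i : phi (a ^+ i) = iter i (mul (phi a)) one.
Proof. by rewrite -[a ^+ i]mulr1 hom_exprM phi1. Qed.

(** This and the next lemmas are equivalences because they serve twice: from right to left to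
    extract identities in H from its presentation, from left to right to check the relations of the
    double. Powers are iterates since [mul] need not be a ring product. *)
Lemma hom_expr_eq1 a n : iter n (mul (phi a)) one = one <-> phi (a ^+ n - 1) = 0.
Proof.
rewrite (linD _ _ lphi) (linN _ lphi) hom_expr phi1.
by split=> [->|/eqP]; rewrite ?subrr // subr_eq0 => /eqP.
Qed.

Lemma hom_qcommute a b c : mul (phi a) (phi b) = c *: mul (phi b) (phi a)
  <-> phi (a * b - c *: (b * a)) = 0.
Proof.
rewrite (linD _ _ lphi) (linN _ lphi) (linZ _ _ lphi) !phiM.
by split=> [->|/eqP]; rewrite ?subrr // subr_eq0 => /eqP.
Qed.

Lemma hom_commute a b : mul (phi a) (phi b) = mul (phi b) (phi a)
  <-> phi (a * b - b * a) = 0.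
Proof. by have := hom_qcommute a b 1; rewrite !scale1r. Qed.

Lemma hom_commutator a b c i d j :
  mul (phi a) (phi b) = mul (phi b) (phi a)
    + (iter i (mul (phi c)) one - iter j (mul (phi d)) one)
  <-> phi (a * b - b * a - (c ^+ i - d ^+ j)) = 0.
Proof.
have phiB u v : phi (u - v) = phi u - phi v.
  by rewrite (linD _ _ lphi) (linN _ lphi).
rewrite 3!phiB !phiM !hom_expr -addrA -opprD.
by split=> [->|/eqP]; rewrite ?subrr // subr_eq0 => /eqP.
Qed.

End ImageOfRelations.

Lemma is_Hn_relations (k : fieldType) (n m t : nat) (zeta : k) (H : hopfAlgType k)
    (y x : H) : is_Hn n m t zeta y x ->
  [/\ y ^+ n = 1, x ^+ Hn_order n m t = 0 & y * x = zeta ^+ t *: (x * y)].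
Proof.
case=> [[phi [[phi1 phiM] phig _ ker] _ _]].
have lphi : linear phi by move=> c a b; rewrite linearP.
have py : phi (free_gen k (0 : 'I_2)) = y by rewrite phig.
have px : phi (free_gen k (1 : 'I_2)) = x by rewrite phig.
have rel0 a : a \in Hn_rels n m t zeta -> phi a = 0.
  by move=> ra; apply/ker; exact: ideal_rel.
have iterE (a : H) i : iter i ( *%R a) 1 = a ^+ i.
  by elim: i => [|i IH] //; rewrite iterS IH exprS.
split.
- by rewrite -py -iterE; apply/(hom_expr_eq1 lphi phi1 phiM)/rel0; rewrite !inE eqxx.
- by rewrite -px -iterE -(hom_expr phi1 phiM) rel0 // !inE eqxx orbT.
- by rewrite -py -px; apply/(hom_qcommute lphi phiM)/rel0; rewrite !inE eqxx !orbT.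
Qed.

Lemma is_Hn_ind (k : fieldType) (n m t : nat) (zeta : k) (H : hopfAlgType k)
    (y x : H) (P : H -> Prop) : is_Hn n m t zeta y x ->
  P 1 -> (forall a, P a -> P (y * a)) -> (forall a, P a -> P (x * a)) ->
  (forall c a b, P a -> P b -> P (c *: a + b)) -> forall a, P a.
Proof.
case=> [[phi [[phi1 phiM] phig phi_surj _] _ _]] P1 Py Px PD a.
have [b <-] := phi_surj a.
elim/free_alg_ind: b => [|i b Pb|c b b' Pb Pb'].
- by rewrite phi1.
- by rewrite phiM phig; case: i => [[|[|//]] lti]; [exact: Py | exact: Px].
by rewrite linearP; exact: PD.
Qed.

(** N = 1 would mean gcd(n, mt) = n, that is, n divides mt. *)
Lemma Hn_order_gt1 n m t : (0 < n)%N -> ~~ (n %| m * t)%N -> (1 < Hn_order n m t)%N.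
Proof.
move=> n_gt0 ndvd; have gt0 : (0 < gcdn n (m * t))%N by rewrite gcdn_gt0 n_gt0.
rewrite /Hn_order ltn_divRL ?dvdn_gcdl // mul1n.
rewrite ltn_neqAle dvdn_leq ?dvdn_gcdl // andbT.
by apply: contra ndvd => /eqP <-; exact: dvdn_gcdr.
Qed.

Lemma Hn_order_prim (k : fieldType) n m t (zeta : k) :
  n.-primitive_root zeta -> (Hn_order n m t).-primitive_root (zeta ^+ (m * t)).
Proof. by move=> zprim; rewrite /Hn_order gcdnC; exact: exp_prim_root. Qed.

Lemma double_rels_span (k : fieldType) (n m t : nat) (zeta : k) (a : free_alg k 4) :
  (0 < n)%N ->
  let G i := free_gen k (i : 'I_4) in
  in_span (double_rels n m t zeta) n (Hn_order n m t)
    (G 0) (G 1) (G 2%:R) (G 3%:R) a.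
Proof.
move=> n_gt0 G; set rels := double_rels _ _ _ _.
(* The relators are read by position in [double_rels] and match the congruences by conversion,
   except the last, where the commutator has to be regrouped. *)
have rel i : (i < 10)%N -> two_sided_ideal rels (nth 0 rels i).
  by move=> lti; apply: ideal_rel; apply: mem_nth.
have r0 : cong rels (G 0 ^+ n) 1 := rel 0 isT.
have r1 : cong rels (G 1 ^+ n) 1 := rel 1 isT.
have r2 : two_sided_ideal rels (G 2%:R ^+ _) := rel 2 isT.
have r3 : two_sided_ideal rels (G 3%:R ^+ _) := rel 3 isT.
have r4 : cong rels (G 0 * G 2%:R) (zeta ^+ t *: (G 2%:R * G 0)) := rel 4 isT.
have r5 : cong rels (G 1 * G 3%:R) (zeta ^+ m *: (G 3%:R * G 1)) := rel 5 isT.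
have r6 : cong rels (G 0 * G 1) (G 1 * G 0) := rel 6 isT.
have r7 : cong rels (G 2%:R * G 1) (zeta ^+ m *: (G 1 * G 2%:R)) := rel 7 isT.
have r8 : cong rels (G 0 * G 3%:R) (zeta ^- t *: (G 3%:R * G 0)) := rel 8 isT.
have r9 : cong rels (G 2%:R * G 3%:R) (G 3%:R * G 2%:R + (G 1 ^+ t - G 0 ^+ m)).
  by rewrite /cong opprD addrA; exact: (rel 9 isT).
apply: (in_span_total (@free_scalerAr k 4) n_gt0 r0 r1 r2 r3 r4 r5 r6 r7 r8 r9).
move=> P P1 Py PY Px PX PD; apply: (free_alg_ind P1 _ PD) => i b Pb.
case: i => [[|[|[|[|//]]]] lti].
- have -> : Ordinal lti = 0 by exact: val_inj.
  exact: (Py b Pb).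
- have -> : Ordinal lti = 1 by exact: val_inj.
  exact: (PY b Pb).
- have -> : Ordinal lti = 2%:R by exact: val_inj.
  exact: (Px b Pb).
have -> : Ordinal lti = 3%:R by exact: val_inj.
exact: (PX b Pb).
Qed.

Theorem proposition4p15 (k : closedFieldType) (n m t : nat) (zeta : k)
    (H : hopfAlgType k) (y x : H) (Y X : 'Hom(H, k^o)) :
  [pchar k] =i pred0 ->
  (0 < n)%N -> (m %| n)%N -> (t %| n)%N -> ~~ (n %| m * t)%N ->
  n.-primitive_root zeta ->
  is_Hn n m t zeta y x ->
  (forall i j : nat, (i < Hn_order n m t)%N -> (j < n)%N ->
     Y (x ^+ i * y ^+ j) = (i == 0%N)%:R * zeta ^+ j) ->
  (forall i j : nat, (i < Hn_order n m t)%N -> (j < n)%N ->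
     X (x ^+ i * y ^+ j) = (i == 1%N)%:R) ->
  let Delta := @double_comul k H in
  let eps := @double_counit k H in
  let one := double_one H in
  let yD := double_inr y in
  let YD := double_inl Y in
  let xD := double_inr x in
  let XD := double_inl X in
  [/\ grouplike Delta eps yD,
      grouplike Delta eps YD,
      skew_primitive Delta eps (double_exp yD m) one xD,
      skew_primitive Delta eps one (double_exp YD t) XD
    & presented_by (@double_mul k H) one (tnth [tuple yD; YD; xD; XD])
        (double_rels n m t zeta)].
Proof.
move=> char0 n_gt0 _ _ ndvd zprim isHn Y_basis X_basis Delta eps one yD YD xD XD.
have N_gt1 := Hn_order_gt1 n_gt0 ndvd.
have qprim := Hn_order_prim m t zprim.
have zn := prim_expr_order zprim.
(* Invertibility of n is what the Fourier inversion in [pcoef] and [hcoef] requires. *)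
have n_neq0 : n%:R != 0 :> k by move/pcharf0P: char0 => ->; rewrite -lt0n.
have [yn xN yx] := is_Hn_relations isHn.
have H_ind := fun P => is_Hn_ind (P := P) isHn.
have [_ [Dy ey] [_ _ Dx]] := isHn.
set N := Hn_order n m t in N_gt1 qprim xN Y_basis X_basis.
have Y1 : Y 1 = 1.
  have := Y_basis 0 0; rewrite !mul1r expr0; apply=> //; exact: ltnW.
split.
- exact: grouplike_inr.
- apply: grouplike_inl Y1.
  exact: (dual_comul_Y n_gt0 N_gt1 zn yn xN yx H_ind Y_basis).
- exact: (skew_primitive_x n_gt0 yn H_ind Dy ey Dx).
- exact: (skew_primitive_X n_gt0 N_gt1 zn yn xN yx H_ind Dy ey Dx Y_basis X_basis).
pose g := tnth [tuple yD; YD; xD; XD].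
have mull v : linear ((@double_mul k H)^~ v) by exact: lin_double_mull.
have mulr v : linear (@double_mul k H v) by exact: lin_double_mulr.
have mul1 := double_mul_1 n_gt0 yn H_ind Dy ey Dx.
have mulgA := double_mul_gen_assoc Y X n_gt0 yn H_ind Dy ey Dx.
have exp_y := double_exp_y n_gt0 yn H_ind Dy ey Dx.
have exp_x := double_exp_x n_gt0 yn H_ind Dy ey Dx.
have exp_inl := double_exp_inl n_gt0 yn H_ind Dy ey Dx.
(* The right unit law on generators is the formula for powers at exponent 1. *)
have mulg1 i : double_mul (g i) one = g i.
  case: i => [[|[|[|[|//]]]] lti]; rewrite /g /tnth /=.
  - exact: (exp_y 1).
  - exact: etrans (exp_inl Y 1) (congr1 _ (dual_mulp1 Y)).
  - exact: (exp_x 1).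
  - exact: etrans (exp_inl X 1) (congr1 _ (dual_mulp1 X)).
pose phi := free_eval (@double_mul k H) one g.
have lphi : linear phi := free_eval_linear _ _ _.
have phi1 : phi 1 = one := free_eval1 _ _ _.
have phi_genM := free_eval_genM one g mulr.
have phiM a b : phi (a * b) = double_mul (phi a) (phi b).
  exact: (eval_multiplicative (@free_alg_ind k 4) mull mul1 mulgA lphi phi1
            phi_genM).
have phig i : phi (free_gen k i) = g i.
  exact: (eval_gen phi1 phi_genM (mulg1 i)).
pose M (e : 'I_N * 'I_n * ('I_N * 'I_n)) :=
  normal_word (free_gen k (0 : 'I_4)) (free_gen k (1 : 'I_4))
    (free_gen k (2%:R : 'I_4)) (free_gen k (3%:R : 'I_4)) e.1.1 e.1.2 e.2.1 e.2.2.
(* Normal words go to the product basis of the double, so spanning modulo the relations can be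
   compared with independence of the images. *)
have phi_M e : phi (M e)
    = dual_monom Y X e.1.1 e.1.2 \tens (x ^+ e.2.1 * y ^+ e.2.2).
  rewrite /M /normal_word !(hom_exprM phiM) (hom_expr phi1 phiM) !phig.
  exact: (double_monomE Y X n_gt0 yn H_ind Dy ey Dx).
have expn1 := hom_expr_eq1 lphi phi1 phiM.
have comm := hom_qcommute lphi phiM.
apply: (presented_by_basis mull mulr mul1 mulg1 mulgA (M := M)).
(* As a boolean [all], the condition unfolds into ten goals in the order of [double_rels]. *)
- suff /allP rel0 : all (fun a => phi a == 0) (double_rels n m t zeta).
    by move=> a /rel0 /eqP.
  rewrite /double_rels /= -/N.
  have gE : (g 0 = yD) * (g 1 = YD) * (g 2%:R = xD) * (g 3%:R = XD) by [].
  do ![apply/andP; split] => //; apply/eqP.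
  + apply/expn1; rewrite phig; apply: etrans (exp_y n) _; by rewrite yn.
  + apply/expn1; rewrite phig; apply: etrans (exp_inl Y n) _; congr (_ \tens _).
    exact: (Yexp_order n_gt0 N_gt1 zn yn xN yx H_ind Dy ey Dx Y_basis).
  + rewrite (hom_expr phi1 phiM) phig; apply: etrans (exp_x N) _.
    rewrite xN; exact: (lin0 (lin_tensr _ (@lin_id _ _))).
  + rewrite (hom_expr phi1 phiM) phig; apply: etrans (exp_inl X N) _.
    rewrite (Xexp_order n_gt0 N_gt1 zn yn xN yx H_ind Dy ey Dx Y_basis X_basis).
    exact: tens0l.
  + apply/comm; rewrite !phig; exact: (double_rel_yx n_gt0 yn yx H_ind Dy ey Dx).
  + apply/comm; rewrite !phig.
    exact: (double_rel_YX n_gt0 N_gt1 zn yn xN yx H_ind Dy ey Dx Y_basis X_basis).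
  + apply/(hom_commute lphi phiM); rewrite !phig.
    exact: (double_rel_yY n_gt0 N_gt1 zn yn xN yx H_ind Dy ey Dx Y_basis).
  + apply/comm; rewrite !phig.
    exact: (double_rel_xY n_gt0 N_gt1 zn yn xN yx H_ind Dy ey Dx Y_basis).
  + apply/comm; rewrite !phig.
    exact: (double_rel_yX n_gt0 N_gt1 zn yn xN yx H_ind Dy ey Dx Y_basis X_basis).
  + apply/(hom_commutator lphi phi1 phiM); rewrite !phig.
    apply: etrans (double_rel_xX n_gt0 N_gt1 zn yn xN yx H_ind Dy ey Dx Y_basis
                     X_basis) _.
    by congr (_ + (_ - _)); apply/esym; [exact: (exp_inl Y t) | exact: (exp_y m)].
- by move=> a; exact: double_rels_span.
- move=> c c0.
  apply: (double_monom_free n_gt0 N_gt1 zn yn xN yx H_ind Dy ey Dx Y_basis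
            X_basis zprim qprim n_neq0).
  by rewrite -[RHS]c0; apply: eq_bigr => e _; rewrite -phi_M.
- move=> w.
  have [c ->] := double_monom_span n_gt0 N_gt1 zn yn xN yx H_ind Dy ey Dx
    Y_basis X_basis zprim qprim n_neq0 w.
  by exists c; apply: eq_bigr => e _; rewrite -phi_M.
Qed.
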